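(* Fix a permutation $\sigma$ of $\{1,\dots,n\}$ of order $m$, and assume that $\sigma$ is a product of $p$ disjoint cycles of lengths $n_1,\dots,n_p$ (with $\sum_i n_i=n$). Let $N=\sum_{i=1}^p(n_i-1)$, and let $\mathbb Z_m$ act on $\Pi_{n-1}$ through $\sigma$ by permuting coordinates. Then there is a smooth diffeomorphism $\psi$ taking $\Pi_{n-1}^{\mathbb Z_m}$ to the permutohedron $\Pi_{n-N-1}$. For a partition $\mathfrak p$ of $\{1,\dots,n\}$, if $\Pi_{\mathfrak p}^{\mathbb Z_m}=\Pi_{\mathfrak p}\cap\Pi_{n-1}^{\mathbb Z_m}$ is not empty, then $\psi(\Pi_{\mathfrak p}^{\mathbb Z_m})$ is the face $\Pi_{\mathfrak p^B}$ of $\Pi_{n-N-1}$, where $B$ is the set obtained from $\{1,\dots,n\}$ by removing the smallest element of each cycle of $\sigma$.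
   Context: $\Pi_{r-1}\subset\mathbb R^r$ is the convex hull of the points $(\tau(1),\dots,\tau(r))$ over all permutations $\tau$ of $\{1,\dots,r\}$, regarded as a manifold with corners. The generator of $\mathbb Z_m$ acts on $\mathbb R^n$ by $(x_1,\dots,x_n)\mapsto(x_{\sigma(1)},\dots,x_{\sigma(n)})$, preserving $\Pi_{n-1}$. Fixed points of $\sigma$ count as cycles of length $1$. Partitions are ordered partitions into non-empty subsets. The face $\Pi_{\mathfrak p}$ of $\Pi_{r-1}$ associated with $\mathfrak p=(\mathcal P_1,\dots,\mathcal P_{k+1})$ is cut out by the equations $\sum_{i\in\mathcal P_1\cup\dots\cup\mathcal P_j}x_i=1+2+\dots+(|\mathcal P_1|+\dots+|\mathcal P_j|)$, $j=1,\dots,k$. Reduction: if $\mathfrak p$ is a partition of $\{1,\dots,r\}$ with no $\mathcal P_i$ equal to $\{b\}$, then $\mathfrak p^b=(\mathcal P_1^b,\dots,\mathcal P_{k+1}^b)$ is the partition of $\{1,\dots,r-1\}$ in which $x\in\mathcal P_i$, $x<b$ contributes $x\in\mathcal P_i^b$ and $x\in\mathcal P_i$, $x>b$ contributes $x-1\in\mathcal P_i^b$. If $B\subset\{1,\dots,r\}$ and no $\mathcal P_i$ is contained in $B$, then $\mathfrak p^B$ is obtained by successive reductions with respect to the elements of $B$, from the largest to the smallest. *)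

(* Defs.v *)
From mathcomp Require Import all_boot all_order all_algebra all_fingroup finmap.
From mathcomp Require Import all_classical all_reals all_analysis.

Set Implicit Arguments.
Unset Strict Implicit.
Unset Printing Implicit Defensive.

Import Order.TTheory GRing.Theory Num.Theory.
Import numFieldNormedType.Exports.

Local Open Scope classical_set_scope.
Local Open Scope ring_scope.

(* Indices are shifted by one: {1, ..., r} is encoded as 'I_r, or as
   {0, ..., r-1} when its subsets are taken in {fset nat}.  Only the labels are
   shifted; the coordinates of the points of the permutohedron are unchanged. *)

Section Smooth.
Context {R : realType} {V W : normedModType R}.

(* C^k on U, meant for U open. *)
Fixpoint Ck (k : nat) (U : set V) (g : V -> W) : Prop :=
  (forall x, U x -> {for x, continuous g}) /\
  match k with
  | 0 => True
  | k'.+1 => forall v : V,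
      (forall x, U x -> derivable g x v) /\ Ck k' U ('D_v g)
  end.

Definition Cinfty (U : set V) (g : V -> W) : Prop := forall k, Ck k U g.

(* Smoothness on an arbitrary subset: local existence of smooth extensions.
   On a simple polytope this is smoothness for its structure of manifold with
   corners, whose charts are restrictions of affine maps. *)
Definition smooth_on (A : set V) (f : V -> W) : Prop :=
  forall x, A x -> exists (U : set V) (g : V -> W),
    [/\ open U, U x, Cinfty U g & forall y, A y -> U y -> f y = g y].

End Smooth.

Definition diffeomorphism_on {R : realType} {V W : normedModType R}
    (A : set V) (B : set W) (f : V -> W) : Prop :=
  [/\ set_bij A B f, smooth_on A f &
      exists g : W -> V, (forall x, A x -> g (f x) = x) /\ smooth_on B g].

Definition perm_point (R : realType) (r : nat) (tau : 'S_r) : 'rV[R]_r :=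
  \row_i (tau i).+1%:R.

(* permutohedron R r is the paper's \Pi_{r-1}, a subset of R^r. *)
Definition permutohedron (R : realType) (r : nat) : set 'rV[R]_r :=
  [set x | exists w : 'S_r -> R,
    [/\ forall tau, 0 <= w tau, \sum_tau w tau = 1 &
        x = \sum_tau w tau *: perm_point R tau]].
Arguments permutohedron : clear implicits.

(* k in Z_m acts by the k-th iterate of the generator's action
   x |-> (x_(sigma 1), ..., x_(sigma n)), which is col_perm sigma. *)
Definition fixed_points (R : realType) (n m : nat) (sigma : 'S_n)
    (A : set 'rV[R]_n) : set 'rV[R]_n :=
  A `&` [set x | forall k, (k < m)%N -> iter k (col_perm sigma) x = x].

Definition face (R : realType) (r : nat) (p : seq {fset nat}) :
    set 'rV[R]_r :=
  permutohedron R r `&` [set x | forall j, (0 < j < size p)%N ->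
    \sum_(i < r | val i \in (\bigcup_(P <- take j p) P)%fset) x 0 i =
    (\sum_(1 <= k < (\sum_(P <- take j p) #|` P|).+1) k)%N%:R].
Arguments face : clear implicits.

Definition ordered_partition (r : nat) (p : seq {fset nat}) : bool :=
  [&& all (fun P => P != fset0) p, pairwise fdisjoint p &
      (\bigcup_(P <- p) P == [fset x in iota 0 r])%fset].

(* p^b; it is meaningful only if no block of p equals [fset b]. *)
Definition reduction (p : seq {fset nat}) (b : nat) : seq {fset nat} :=
  [seq [fset (if (x < b)%N then x else x.-1) | x in (P `\ b)%fset]%fset
    | P : {fset nat} <- p].

(* p^B; it is meaningful only if no block of p is contained in B. *)
Definition reductions (p : seq {fset nat}) (B : {fset nat}) : seq {fset nat} :=
  foldl reduction p (sort geq B).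

(* porbits sigma consists of the cycles of sigma, fixed points included. *)
Definition nonminimal (n : nat) (sigma : 'S_n) : {fset nat} :=
  [fset val i | i in 'I_n & ~~ [forall j in porbit sigma i, (i <= j)%N]]%fset.

(* Main.v *)
Require Import Defs.
From mathcomp Require Import all_boot all_order all_algebra all_fingroup finmap.
From mathcomp Require Import all_classical all_reals all_analysis.
From mathcomp Require Import ring lra zify.

Set Implicit Arguments.
Unset Strict Implicit.
Unset Printing Implicit Defensive.

Import Order.TTheory GRing.Theory Num.Theory.
Import numFieldNormedType.Exports.

Local Open Scope classical_set_scope.
Local Open Scope ring_scope.

(** The fixed points of sigma are the x constant on the cycles; in the coordinates
    z_C = |C| x_C they form the polytope of the z with z(S) >= tri(sum of the |C|,
    C in S), where tri k = 1 + ... + k. By strict convexity of tri it has the same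
    normal fan as the standard permutohedron on the set of cycles, whose toric
    variety is smooth. A diffeomorphism is then given by an explicit rational map:
    the moment map of the standard permutohedron after the gradient of the
    symplectic potential of the first polytope, i.e. the weight of the vertex tau
    is the product over S of (slack of S at z) ^ (excess of tau over S).
    It preserves all facets; it is injective, and so is its derivative up to the
    boundary, by strict convexity of the two potentials; smoothness of the inverse
    is the inverse function theorem. Surjectivity is an open-closed argument along
    segments, and it yields Rado's description of the permutohedron by
    inequalities, the case where all cycles are points. *)

(** * Smooth functions *)

(** Both polytopes have the same facet normals, but at distances that are not proportional, so in
    general no affine map does; the obstacle is smoothness at the corners. The exponents in the
    weights are slacks of integer points, hence natural numbers: the logarithms of the potentials
    disappear and the weights are polynomials in the slacks, defined beyond the boundary. By strict
    supermodularity the tight sets of a point form a chain, and a permutation adapted to this chain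
    has positive weight, so the normalizing sum does not vanish on the polytope. Injectivity and its
    infinitesimal form share a pattern. A vanishing sum of nonnegative terms over the vertices makes
    a combination of the excesses, with coefficients a_S, constant on the vertices of a face. For z
    tangent to that face this gives that the sum of the a_S z(S) is 0, and with a_S a difference or
    a derivative of logarithms of slacks, this is again a sum of nonnegative terms, now over
    subsets. Directions transverse to the face escape the argument; there a vertex at height exactly
    1 over the facet makes the first derivative nonzero. *)

Section Smooth_calculus.
Context {R : realType}.
Implicit Types (V W : normedModType R).

(* Stronger than Ck: differentiability is in Frechet's sense, so that the chain rule holds. *)
Fixpoint Dk {V W} (k : nat) (U : set V) (g : V -> W) : Prop :=
  (forall x, U x -> differentiable g x) /\
  match k with
  | 0 => True
  | k'.+1 => forall v : V, Dk k' U ('D_v g)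
  end.

Lemma Dk_diff V W k U (g : V -> W) x : Dk k U g -> U x -> differentiable g x.
Proof. by case: k => [|k] [+ _] => /[apply]. Qed.

Lemma Dk_Ck V W k U (g : V -> W) : Dk k U g -> Ck k U g.
Proof.
elim: k g => [|k IH] g [Dg Hg].
  by split=> // x Ux; apply: differentiable_continuous; exact: Dg.
split=> [x Ux|v]; first by apply: differentiable_continuous; exact: Dg.
by split=> [x Ux|]; [apply: diff_derivable (Dg x Ux)|exact: IH (Hg v)].
Qed.

Lemma DkW V W k U (g : V -> W) : Dk k.+1 U g -> Dk k U g.
Proof.
elim: k g => [|k IH] g [Dg Hg]; first by [].
by split=> // v; exact: IH (Hg v).
Qed.

Lemma Dk_sub V W k (U U' : set V) (g : V -> W) :
  U' `<=` U -> Dk k U g -> Dk k U' g.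
Proof.
move=> UU; elim: k g => [|k IH] g [Dg Hg].
  by split=> // x /UU; exact: Dg.
by split=> [x /UU|v]; [exact: Dg|exact: IH (Hg v)].
Qed.

Lemma is_diff_eps V W (f : V -> W) (L : {linear V -> W}) x : continuous L ->
  (forall e, 0 < e ->
     \forall h \near 0, `|f (h + x) - f x - L h| <= e * `|h|) ->
  is_diff x f L.
Proof.
move=> Lc H.
have dxf : f \o shift x = cst (f x) + L +o_ 0 id.
  by apply/eqaddoP => e e0; apply: filterS (H e e0) => h /=; rewrite !fctE /= opprD addrA.
have dE := diff_unique Lc dxf.
by constructor=> //; apply/diff_locallyP; rewrite dE.
Qed.

Lemma diff_epsP V W (f : V -> W) x e : differentiable f x -> 0 < e ->
  \forall h \near 0, `|f (h + x) - f x - 'd f x h| <= e * `|h|.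
Proof.
move=> /diff_locally/eqaddoP H e0; apply: filterS (H e e0) => h /=.
by rewrite !fctE /= opprD addrA.
Qed.

Lemma near_eq_differentiable V W (f g : V -> W) x :
  {near x, f =1 g} -> differentiable f x -> differentiable g x.
Proof.
move=> fg df; suff [] : is_diff x g ('d f x) by [].
apply: (@is_diff_eps _ _ _ ('d f x)) => [|e e0]; first exact: diff_continuous.
have fgx : f x = g x by exact: nbhs_singleton fg.
have fg0 : \forall h \near 0, f (h + x) = g (h + x).
  by move: fg; rewrite (near_shift 0) subr0.
near=> h; rewrite -fgx -(near fg0 h) //; near: h; exact: diff_epsP.
Unshelve. all: by end_near. Qed.

(** Derivatives depend only on germs, so agreement on U passes to them because U is open; this is
    why openness accompanies the rules below. *)
Lemma Dk_ext V W k (U : set V) (f g : V -> W) : open U ->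
  (forall x, U x -> f x = g x) -> Dk k U f -> Dk k U g.
Proof.
move=> oU; elim: k f g => [|k IH] f g fg [Df Hf].
  split=> // x Ux; apply: near_eq_differentiable (Df x Ux).
  by near=> y; apply: fg; near: y; exact: open_nbhs_nbhs.
have Hn : forall x, U x -> {near x, f =1 g}.
  by move=> x Ux; near=> y; apply: fg; near: y; exact: open_nbhs_nbhs.
split=> [x Ux|v]; first by apply: near_eq_differentiable (Df x Ux); exact: Hn.
by apply: IH (Hf v) => x Ux; apply: near_eq_derive; exact: Hn.
Unshelve. all: by end_near. Qed.

Lemma Dk_cst V W k U (c : W) : Dk k U (cst c : V -> W).
Proof.
elim: k c => [|k IH] c; first by split=> // x _; exact: differentiable_cst.
split=> [x _|v]; first exact: differentiable_cst.
have -> : 'D_v (cst c : V -> W) = cst 0 by apply/funext => x; rewrite derive_cst.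
exact: IH.
Qed.

Lemma DkD V W k U (f g : V -> W) : open U ->
  Dk k U f -> Dk k U g -> Dk k U (f \+ g).
Proof.
move=> oU; elim: k f g => [|k IH] f g [Df Hf] [Dg Hg].
  by split=> // x Ux; apply: differentiableD; [exact: Df|exact: Dg].
split=> [x Ux|v]; first by apply: differentiableD; [exact: Df|exact: Dg].
apply: Dk_ext (IH _ _ (Hf v) (Hg v)) => // x Ux.
by rewrite deriveD //; apply: diff_derivable; [exact: Df|exact: Dg].
Qed.

Lemma DkM V k U (f g : V -> R) : open U ->
  Dk k U f -> Dk k U g -> Dk k U (f \* g).
Proof.
move=> oU; elim: k f g => [|k IH] f g Sf Sg; have [Df Hf] := Sf; have [Dg Hg] := Sg.
  by split=> // x Ux; apply: differentiableM; [exact: Df|exact: Dg].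
split=> [x Ux|v]; first by apply: differentiableM; [exact: Df|exact: Dg].
have H := DkD oU (IH _ _ (DkW Sf) (Hg v)) (IH _ _ (DkW Sg) (Hf v)).
apply: Dk_ext H => // x Ux.
by rewrite deriveM //; apply: diff_derivable; [exact: Df|exact: Dg].
Qed.

(** The derivative of 1/f is - (1/f)^2 f', where 1/f itself is covered by the induction on k. *)
Lemma DkV V k U (f : V -> R) : open U -> (forall x, U x -> f x != 0) ->
  Dk k U f -> Dk k U (fun x => (f x)^-1).
Proof.
move=> oU f0; elim: k => [|k IH] Sf; have [Df Hf] := Sf.
  by split=> // x Ux; apply: differentiableV; [exact: Df|exact: f0].
split=> [x Ux|v]; first by apply: differentiableV; [exact: Df|exact: f0].
have iS := IH (DkW Sf).
have H := DkM oU (Dk_cst (W:=R) k U (-1)) (DkM oU (DkM oU iS iS) (Hf v)).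
apply: Dk_ext H => // x Ux.
rewrite deriveV; [|exact: f0|by apply: diff_derivable; exact: Df].
by rewrite /= mulN1r scaleNr expr2 invfM.
Qed.

Lemma Dk_sum V W k U (I : Type) (r : seq I) (P : pred I) (f : I -> V -> W) :
  open U -> (forall i, P i -> Dk k U (f i)) ->
  Dk k U (fun x => \sum_(i <- r | P i) f i x).
Proof.
move=> oU Sf; elim: r => [|i r IH].
  by apply: Dk_ext (Dk_cst k U 0) => // x _; rewrite big_nil.
have [Pi|nPi] := boolP (P i); last first.
  by apply: Dk_ext IH => // x _; rewrite big_cons (negPf nPi).
apply: Dk_ext (DkD oU (Sf i Pi) IH) => // x _.
by rewrite big_cons Pi.
Qed.

Lemma Dk_prod V k U (I : Type) (r : seq I) (P : pred I) (f : I -> V -> R) :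
  open U -> (forall i, P i -> Dk k U (f i)) ->
  Dk k U (fun x => \prod_(i <- r | P i) f i x).
Proof.
move=> oU Sf; elim: r => [|i r IH].
  by apply: Dk_ext (Dk_cst (W:=R) k U 1) => // x _; rewrite big_nil.
have [Pi|nPi] := boolP (P i); last first.
  by apply: Dk_ext IH => // x _; rewrite big_cons (negPf nPi).
apply: Dk_ext (DkM oU (Sf i Pi) IH) => // x _.
by rewrite big_cons Pi.
Qed.

Lemma DkX V k U (f : V -> R) n : open U ->
  Dk k U f -> Dk k U (fun x => f x ^+ n).
Proof.
move=> oU Sf; elim: n => [|n IH].
  by apply: Dk_ext (Dk_cst (W:=R) k U 1) => // x _; rewrite expr0.
by apply: Dk_ext (DkM oU Sf IH) => // x _; rewrite exprS.
Qed.

Lemma linear_rV_continuous n W (f : {linear 'rV[R]_n -> W}) : continuous f.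
Proof.
move=> x; apply: differentiable_continuous.
have -> : (f : _ -> _) = \sum_j (fun y : 'rV_n => y 0 j *: f (delta_mx 0 j)).
  apply/funext => y; rewrite [in LHS](row_sum_delta y) linear_sum fct_sumE.
  by apply: eq_bigr => j _; rewrite linearZ.
apply: differentiable_sum => j; apply: differentiableZl.
exact: differentiable_coord.
Qed.

Lemma Dk_linear V W k U (f : {linear V -> W}) : continuous f -> Dk k U f.
Proof.
move=> cf; case: k => [|k].
  by split=> // x _; exact: linear_differentiable.
split=> [x _|v]; first exact: linear_differentiable.
suff -> : 'D_v f = cst (f v) by exact: Dk_cst.
apply/funext => x; rewrite deriveE; last exact: linear_differentiable.
by rewrite diff_lin.
Qed.

Lemma DkZl V W k U (f : V -> R) (w : W) : open U ->
  Dk k U f -> Dk k U (fun x => f x *: w).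
Proof.
move=> oU; elim: k f => [|k IH] f [Df Hf].
  by split=> // x Ux; apply: differentiableZl; exact: Df.
split=> [x Ux|v]; first by apply: differentiableZl; exact: Df.
apply: Dk_ext (IH _ (Hf v)) => // x Ux.
rewrite !deriveE; [|by apply: differentiableZl; exact: Df|exact: Df].
by rewrite diffZl //; exact: Df.
Qed.

Lemma Dk_rV V k U n (g : V -> 'rV[R]_n) : open U ->
  (forall j, Dk k U (fun x => g x 0 j)) -> Dk k U g.
Proof.
move=> oU Sg.
have H : Dk k U (fun x => \sum_j g x 0 j *: (delta_mx 0 j : 'rV[R]_n)).
  by apply: Dk_sum => // j _; apply: DkZl; first exact: oU; exact: Sg.
by apply: Dk_ext H => // x _; rewrite -row_sum_delta.
Qed.

Lemma differentiable_entry V m n (g : V -> 'M[R]_(m, n)) i j x :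
  differentiable g x -> differentiable (fun x => g x i j) x.
Proof.
move=> dg.
by apply: (@differentiable_comp _ _ _ _ g (fun M : 'M[R]_(m, n) => M i j)) => //;
  exact: differentiable_coord.
Qed.

Lemma derive_entry V m n (g : V -> 'M[R]_(m, n)) i j v x :
  differentiable g x -> 'D_v (fun x => g x i j) x = ('D_v g x) i j.
Proof.
move=> dg; rewrite derive_mx ?mxE //.
exact: diff_derivable.
Qed.

Lemma Dk_entry V k U m n (g : V -> 'M[R]_(m, n)) i j : open U ->
  Dk k U g -> Dk k U (fun x => g x i j).
Proof.
move=> oU; elim: k g => [|k IH] g [Dg Hg].
  by split=> // x Ux; apply: differentiable_entry; exact: Dg.
split=> [x Ux|v]; first by apply: differentiable_entry; exact: Dg.
apply: Dk_ext (IH _ (Hg v)) => // x Ux.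
by rewrite derive_entry //; exact: Dg.
Qed.

Lemma derive_rVE n W (f : 'rV[R]_n -> W) x v : differentiable f x ->
  'D_v f x = \sum_j v 0 j *: 'D_(delta_mx 0 j) f x.
Proof.
move=> df; rewrite deriveE // {1}(row_sum_delta v) linear_sum.
by apply: eq_bigr => j _; rewrite linearZ deriveE.
Qed.

Lemma derive_comp n V W (f : 'rV[R]_n -> W) (g : V -> 'rV[R]_n) x v :
  differentiable f (g x) -> differentiable g x ->
  'D_v (f \o g) x = 'D_('D_v g x) f (g x).
Proof.
move=> df dg; rewrite !deriveE //; last exact: differentiable_comp.
by rewrite diff_comp.
Qed.

(** In the chain rule the direction ['D_v g x] varies with x, whereas [Dk] speaks of fixed
    directions. Expanding in the standard basis of the middle space gives a sum of products to which
    the induction applies. *)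
Lemma Dk_comp V n k (U : set V) (U' : set 'rV[R]_n) (f : 'rV[R]_n -> R)
    (g : V -> 'rV[R]_n) : open U -> (forall x, U x -> U' (g x)) ->
  Dk k U' f -> Dk k U g -> Dk k U (f \o g).
Proof.
move=> oU gU; elim: k f g gU => [|k IH] f g gU Sf Sg;
  have [Df Hf] := Sf; have [Dg Hg] := Sg.
  by split=> // x Ux; apply: differentiable_comp; [exact: Dg|apply: Df; exact: gU].
split=> [x Ux|v].
  by apply: differentiable_comp; [exact: Dg|apply: Df; exact: gU].
have H : Dk k U (fun x => \sum_j ('D_v g x) 0 j * ('D_(delta_mx 0 j) f \o g) x).
  apply: Dk_sum => // j _; apply: DkM => //; first by apply: Dk_entry => //; exact: Hg.
  by apply: IH => //; [exact: Hf|exact: DkW].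
apply: Dk_ext H => // x Ux.
by rewrite derive_comp ?[RHS]derive_rVE //; [apply: Df; exact: gU..|exact: Dg].
Qed.

Lemma Dk_comp_rV V n m k (U : set V) (U' : set 'rV[R]_n) (f : 'rV[R]_n -> 'rV[R]_m)
    (g : V -> 'rV[R]_n) : open U -> open U' -> (forall x, U x -> U' (g x)) ->
  Dk k U' f -> Dk k U g -> Dk k U (f \o g).
Proof.
move=> oU oU' gU Sf Sg; apply: Dk_rV => // j.
exact: (Dk_comp oU gU (Dk_entry 0 j oU' Sf) Sg).
Qed.

Lemma Dk_det V k U n (M : V -> 'M[R]_n) : open U ->
  (forall i j, Dk k U (fun x => M x i j)) -> Dk k U (fun x => \det (M x)).
Proof.
move=> oU SM; rewrite /determinant; apply: Dk_sum => // s _.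
apply: (@DkM _ _ _ (fun=> _)) => //; first exact: Dk_cst.
by apply: Dk_prod => // i _; exact: SM.
Qed.

(** Cramer's rule: the entries are cofactors divided by the determinant. *)
Lemma Dk_invmx V k U n (M : V -> 'M[R]_n) : open U ->
  (forall x, U x -> M x \in unitmx) ->
  (forall i j, Dk k U (fun x => M x i j)) ->
  forall i j, Dk k U (fun x => invmx (M x) i j).
Proof.
move=> oU uM SM i j.
have S1 : Dk k U (fun x => (\det (M x))^-1).
  apply: DkV => //; last exact: Dk_det.
  by move=> x /uM; rewrite unitmxE unitfE.
have S2 : Dk k U (fun x => (\adj (M x)) i j).
  have S : Dk k U (fun x => (-1) ^+ (j + i) * \det (row' j (col' i (M x)))).
    apply: (@DkM _ _ _ (fun=> _)) => //; first exact: Dk_cst.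
    apply: Dk_det => // a b.
    by apply: Dk_ext (SM (lift j a) (lift i b)) => // x _; rewrite !mxE.
  by apply: Dk_ext S => // x _; rewrite mxE.
apply: Dk_ext (DkM oU S1 S2) => // x Ux.
by rewrite /invmx uM // mxE.
Qed.

(** Counterpart of [smooth_on] with Frechet differentiable extensions, to which the chain rule
    applies; converted back only at the end. *)
Definition Dsmooth_on V W (A : set V) (f : V -> W) : Prop :=
  forall x, A x -> exists (U : set V) (g : V -> W),
    [/\ open U, U x, forall k, Dk k U g & forall y, A y -> U y -> f y = g y].

Lemma Dsmooth_smooth V W (A : set V) (f : V -> W) : Dsmooth_on A f -> smooth_on A f.
Proof.
move=> H x /H[U [g [oU Ux Sg fg]]]; exists U, g; split=> // k.
exact: Dk_Ck.
Qed.

Lemma Dsmooth_comp n m l (A : set 'rV[R]_n) (B : set 'rV[R]_m)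
    (f : 'rV[R]_m -> 'rV[R]_l) (g : 'rV[R]_n -> 'rV[R]_m) :
  (forall x, A x -> B (g x)) -> Dsmooth_on B f -> Dsmooth_on A g ->
  Dsmooth_on A (f \o g).
Proof.
move=> gAB Sf Sg x Ax.
have [U [g' [oU Ux Sg' gg']]] := Sg x Ax.
have [V [f' [oV Vgx Sf' ff']]] := Sf _ (gAB _ Ax).
have oUV : open (U `&` g' @^-1` V).
  rewrite openE => y [Uy Vy]; apply: filterI; first exact: open_nbhs_nbhs.
  have cg : {for y, continuous g'}.
    by apply: differentiable_continuous; exact: (Dk_diff (Sg' 0%N)).
  by apply: cg; exact: open_nbhs_nbhs.
exists (U `&` g' @^-1` V), (f' \o g'); split=> //.
- by split=> //=; rewrite -gg'.
- move=> k.
  apply: (Dk_comp_rV oUV oV) (Sf' k) _ => [y [] //|].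
  by apply: Dk_sub (Sg' k) => y [].
- move=> y Ay [Uy Vy] /=; rewrite gg' // ff' // -gg' //.
  exact: gAB.
Qed.

Lemma Dsmooth_linear n m (A : set 'rV[R]_n) (f : {linear 'rV[R]_n -> 'rV[R]_m}) :
  Dsmooth_on A f.
Proof.
move=> x _; exists setT, f; split=> //; first exact: openT.
by move=> k; exact/Dk_linear/linear_rV_continuous.
Qed.
End Smooth_calculus.

(** * The inverse function theorem *)

Section Inverse_function.
Context {R : realType}.

Lemma rV_norm_le n (x : 'rV[R]_n) (c : R) : 0 <= c ->
  (forall j, `|x 0 j| <= c) -> `|x| <= c.
Proof.
move=> c0 H; rewrite [leLHS]/Num.Def.normr /= mx_normrE; apply: bigmax_le => // -[i j] _ /=.
by rewrite (ord1 i).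
Qed.

Lemma rV_norm_ge n (x : 'rV[R]_n) j : `|x 0 j| <= `|x|.
Proof.
rewrite [leRHS]/Num.Def.normr /= mx_normrE.
exact: (le_bigmax _ (fun ij => `|x ij.1 ij.2|) (0, j)).
Qed.

Lemma linear_rV_bounded n m (L : {linear 'rV[R]_n -> 'rV[R]_m}) :
  exists2 C : R, 0 < C & forall x, `|L x| <= C * `|x|.
Proof.
exists (1 + \sum_j `|L (delta_mx 0 j)|).
  by rewrite ltr_pwDl // sumr_ge0.
move=> x; rewrite {1}(row_sum_delta x) linear_sum.
apply: (le_trans (ler_norm_sum _ _ _)).
rewrite mulrDl mul1r -[leLHS]add0r lerD // mulr_suml ler_sum // => j _.
by rewrite linearZ normrZ mulrC ler_wpM2l // rV_norm_ge.
Qed.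

Lemma ball_line n (x0 x y : 'rV[R]_n) r (t : R) : 0 <= t <= 1 ->
  ball x0 r x -> ball x0 r y -> ball x0 r (t *: (y - x) + x).
Proof.
move=> /andP[t0 t1]; rewrite -!ball_normE /ball_ /= => xr yr.
have -> : x0 - (t *: (y - x) + x) = t *: (x0 - y) + (1 - t) *: (x0 - x).
  apply/matrixP => i j; rewrite !mxE; ring.
have [->|tn0] := eqVneq t 0; first by rewrite scale0r add0r subr0 scale1r.
rewrite (le_lt_trans (ler_normD _ _)) // !normrZ (ger0_norm t0) ger0_norm ?subr_ge0 //.
have -> : r = t * r + (1 - t) * r by ring.
rewrite ltr_leD // ?ltr_pM2l // ?lt0r ?tn0 //.
by rewrite ler_wpM2l ?subr_ge0 // ltW.
Qed.

(** The one-variable mean value theorem along the segment from x to y, hence scalar values; summing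
    the partial derivatives costs the factor n. *)
Lemma mean_value_bound n (e : 'rV[R]_n -> R) (x0 : 'rV[R]_n) (r c : R) : 0 <= c ->
  (forall x, ball x0 r x -> differentiable e x) ->
  (forall (x : 'rV[R]_n) j, ball x0 r x -> `|'D_(delta_mx 0 j) e x| <= c) ->
  forall x y : 'rV[R]_n, ball x0 r x -> ball x0 r y -> `|e y - e x| <= n%:R * c * `|y - x|.
Proof.
move=> c0 De He x y xr yr; pose v := y - x.
pose p := fun t : R => t *: v + x.
have pE (h t : R) : p (h *: 1 + t) = h *: v + p t.
  by rewrite /p scalerDl addrA [h *: 1]mulr1.
have Dep (t : R) : 0 <= t <= 1 -> is_derive t 1 (e \o p) ('D_v e (p t)).
  move=> t01; have de : derivable e (p t) v.
    by apply: diff_derivable; apply: De; exact: ball_line.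
  have E : (fun h : R => h^-1 *: ((e \o p) (h *: 1 + t) - (e \o p) t)) =
      (fun h : R => h^-1 *: (e (h *: v + p t) - e (p t))).
    by apply/funext => h /=; rewrite pE.
  by constructor; rewrite /derivable /derive E.
have [|t||t tI E] := @MVT R (e \o p) (fun t => 'D_v e (p t)) 0 1.
- exact: ltr01.
- by rewrite in_itv /= => /andP[/ltW t0 /ltW t1]; apply: Dep; exact/andP.
- apply: derivable_within_continuous => t; rewrite in_itv /= => t01.
  by have [] := Dep t t01.
move: E; rewrite /= /p scale1r scale0r add0r subrK subr0 mulr1 => ->.
have t01 : 0 <= t <= 1 by move: tI; rewrite in_itv /= => /andP[/ltW-> /ltW->].
have pt : ball x0 r (p t) by exact: ball_line.
rewrite derive_rVE; last exact: De.
rewrite (le_trans (ler_norm_sum _ _ _)) //.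
have -> : n%:R * c * `|y - x| = \sum_(j < n) c * `|y - x|.
  by rewrite sumr_const card_ord -mulrA mulr_natl.
by apply: ler_sum => j _; rewrite normrM mulrC ler_pM // ?He // rV_norm_ge.
Qed.

Lemma derivative_small n m (E : 'rV[R]_n -> 'rV[R]_m) U x0 (c : R) :
  open U -> U x0 -> Dk 1 U E -> (forall v, 'D_v E x0 = 0) -> 0 < c ->
  exists2 r : R, 0 < r & ball x0 r `<=` U /\
    forall x j, ball x0 r x -> `|'D_(delta_mx 0 j) E x| <= c.
Proof.
move=> oU Ux0 [DE HE] E0 c0.
have H : \forall x \near x0, U x /\ forall j, `|'D_(delta_mx 0 j) E x| <= c.
  near=> x; split; first by near: x; exact: open_nbhs_nbhs.
  near: x; apply: filter_forall => j.
  have cj : {for x0, continuous ('D_(delta_mx 0 j) E)}.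
    by apply: differentiable_continuous; apply: (HE (delta_mx 0 j)).1.
  move/cvgrPdist_le : cj => /(_ c c0).
  by rewrite E0; apply: filterS => x; rewrite sub0r normrN.
have [r r0 Hr] := (nbhs_ballP _ _).1 H.
exists r => //; split=> [x /Hr[]//|x j /Hr[_]]; exact.
Unshelve. all: by end_near. Qed.

Lemma contraction_ball n (E : 'rV[R]_n -> 'rV[R]_n) U x0 :
  open U -> U x0 -> Dk 1 U E -> (forall v, 'D_v E x0 = 0) ->
  exists2 r : R, 0 < r & [/\ ball x0 r `<=` U,
    forall x v, ball x0 r x -> `|'D_v E x| <= 2^-1 * `|v| &
    forall x y, ball x0 r x -> ball x0 r y -> `|E y - E x| <= 2^-1 * `|y - x|].
Proof.
move=> oU Ux0 SE E0; have [DE _] := SE.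
(* The factor n of the mean value bound must leave a contraction ratio of 1/2; [n.+1] keeps the
   denominator nonzero when n = 0. *)
pose c : R := (2 * n.+1%:R)^-1.
have c0 : 0 < c by rewrite invr_gt0 mulr_gt0.
have nc : n%:R * c <= 2^-1.
  by rewrite /c invfM mulrCA ler_piMr ?invr_ge0 // ler_pdivrMr // mul1r ler_nat.
have [r r0 [rU Hr]] := derivative_small oU Ux0 SE E0 c0.
exists r => //; split=> // [x v xr|x y xr yr].
  rewrite derive_rVE; last by apply: DE; exact: rU.
  rewrite (le_trans (ler_norm_sum _ _ _)) //.
  apply: (@le_trans _ _ (\sum_(j < n) `|v| * c)).
    by apply: ler_sum => j _; rewrite normrZ ler_pM // ?Hr // rV_norm_ge.
  by rewrite sumr_const card_ord -mulrnAr -mulr_natl mulrC ler_wpM2r.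
apply: rV_norm_le => [|j]; first by rewrite mulr_ge0 ?invr_ge0.
apply: (@le_trans _ _ (n%:R * c * `|y - x|)); last by rewrite ler_wpM2r.
rewrite !mxE; apply: (@mean_value_bound n (fun z => E z 0 j) x0 r) => //.
- exact: ltW.
- by move=> z zr; apply: differentiable_entry; apply: DE; exact: rU.
- move=> z i zr; rewrite derive_entry; last by apply: DE; exact: rU.
  by rewrite (le_trans (rV_norm_ge _ _)) // Hr.
Qed.

(* Minimizing |T x - x| over the ball replaces the iteration of Banach's theorem. *)
Lemma contraction_fixpoint n (T : 'rV[R]_n -> 'rV[R]_n) x0 (s : R) :
  let K := closed_ball_ (fun x => `|x|) x0 s in
  0 <= s -> (forall x, K x -> K (T x)) ->
  (forall x y, K x -> K y -> `|T y - T x| <= 2^-1 * `|y - x|) ->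
  exists2 x, K x & T x = x.
Proof.
move=> K s0 TK Tc.
have Kx0 : K x0 by rewrite /K /closed_ball_ /= subrr normr0.
have cK : compact K.
  apply: bounded_closed_compact.
    exists (`|x0| + s); split; first exact: num_real.
    move=> M M1 x; rewrite /K /closed_ball_ /= => xs.
    rewrite (le_trans _ (ltW M1)) // -[x](subKr x0) (le_trans (ler_normB _ _)) //.
    by rewrite lerD2l.
  exact: closed_closed_ball_.
have cT : {within K, continuous (fun x => `|T x - x|)}.
  apply/subspace_continuousP => x Kx.
  apply/cvgrPdist_le => /= e e0.
  have xe : \forall y \near x, `|y - x| <= 2^-1 * e.
    apply/nbhs_ballP; exists (2^-1 * e); first by rewrite /= mulr_gt0 ?invr_gt0.
    by move=> y; rewrite -ball_normE /= distrC => /ltW.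
  near=> y.
  have Ky : K y by near: y; exact: withinT.
  have H : `|y - x| <= 2^-1 * e by near: y; exact: cvg_within.
  rewrite (le_trans (ler_dist_dist _ _)) //.
  have -> : T x - x - (T y - y) = (y - x) - (T y - T x).
    by apply/matrixP => i j; rewrite !mxE; ring.
  rewrite (le_trans (ler_normB _ _)) //.
  have := Tc x y Kx Ky; lra.
have [x Kx Hx] := EVT_min_rV (ex_intro _ x0 Kx0) cK cT.
exists x; first by rewrite inE in Kx.
have {}Kx : K x by rewrite inE in Kx.
apply/eqP; rewrite -subr_eq0 -normr_eq0.
(* By minimality |T (T x) - T x| is at least |T x - x|, and by contraction at most half of it. *)
have := Hx (T x); rewrite inE => /(_ (TK _ Kx)).
have := Tc _ _ Kx (TK _ Kx).
have := normr_ge0 (T x - x); lra.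
Unshelve. all: by end_near. Qed.
End Inverse_function.

Section Inverse_function_theorem.
Context {R : realType}.

Lemma unitmx_inj n (A : 'M[R]_n) :
  (forall v : 'rV_n, v *m A = 0 -> v = 0) -> A \in unitmx.
Proof.
move=> H; rewrite -row_free_unit -kermx_eq0; apply/rowV0P => v /sub_kermxP.
exact: H.
Qed.

Lemma differentiable_mulmxr (V : normedModType R) n m (F : V -> 'rV[R]_m) (A : 'M[R]_(m, n)) x :
  differentiable F x -> differentiable (fun x => F x *m A) x.
Proof.
move=> dF; apply: (@differentiable_comp _ V _ _ F (mulmxr A)) => //.
exact/linear_differentiable/linear_rV_continuous.
Qed.

Lemma derive_mulmxr n m p (F : 'rV[R]_n -> 'rV[R]_m) (A : 'M[R]_(m, p)) v x :
  differentiable F x -> 'D_v (fun x => F x *m A) x = 'D_v F x *m A.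
Proof.
move=> dF; have cA := @linear_rV_continuous _ _ _ (mulmxr A : {linear 'rV[R]_m -> _}).
rewrite -[LHS]/('D_v (mulmxr A \o F) x) derive_comp //; last exact: linear_differentiable.
by rewrite deriveE ?diff_lin //; exact: linear_differentiable.
Qed.

Lemma Dk_mulmxr n m p k U (F : 'rV[R]_n -> 'rV[R]_m) (A : 'M[R]_(m, p)) :
  open U -> Dk k U F -> Dk k U (fun x => F x *m A).
Proof.
move=> oU SF.
apply: (@Dk_comp_rV _ _ _ _ _ _ setT (mulmxr A)) => //; first exact: openT.
exact/Dk_linear/linear_rV_continuous.
Qed.

(* Newton's map for the equation [F x = y], up to the constant [y *m A]. *)
Let newton n (F : 'rV[R]_n -> 'rV[R]_n) (A : 'M[R]_n) (x : 'rV[R]_n) := x - F x *m A.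

Lemma Dk_newton n k U (F : 'rV[R]_n -> 'rV[R]_n) A : open U ->
  Dk k U F -> Dk k U (newton F A).
Proof.
move=> oU SF; have Sid : Dk k U (@idfun 'rV[R]_n).
  exact/Dk_linear/linear_rV_continuous.
apply: Dk_ext (DkD oU Sid (Dk_mulmxr (- A) oU SF)) => // x _.
by rewrite /newton /= mulmxN.
Qed.

Lemma derive_newton n (F : 'rV[R]_n -> 'rV[R]_n) A v x : differentiable F x ->
  'D_v (newton F A) x = v - 'D_v F x *m A.
Proof.
move=> dF; rewrite (deriveB (f := id)) ?derive_id ?derive_mulmxr //.
by apply: diff_derivable; exact: differentiable_mulmxr.
Qed.

Lemma newton_inj n (F : 'rV[R]_n -> 'rV[R]_n) A x y :
  (forall v : 'rV[R]_n, v *m A = 0 -> v = 0) -> newton F A x = x - y *m A -> F x = y.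
Proof.
move=> Ai /addrI /oppr_inj/eqP; rewrite -subr_eq0 -mulmxBl => /eqP/Ai/eqP.
by rewrite subr_eq0 => /eqP.
Qed.

(** F x = y exactly when x is a fixed point of E + y A, where E = [newton F A] has zero derivative
    at x0 and so contracts near x0. The Lipschitz bound on the inverse is recorded for the proof of
    its differentiability. *)
Lemma local_inverse n (F : 'rV[R]_n -> 'rV[R]_n) U x0 :
  open U -> U x0 -> Dk 1 U F -> (forall v, 'D_v F x0 = 0 -> v = 0) ->
  exists (U' V' : set 'rV[R]_n) (g : 'rV[R]_n -> 'rV[R]_n),
    [/\ open U', U' x0 & U' `<=` U] /\
    [/\ open V',
        forall x, U' x -> V' (F x) /\ g (F x) = x,
        forall y, V' y -> U' (g y) /\ F (g y) = y,
        forall x v, U' x -> 'D_v F x = 0 -> v = 0 &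
        exists2 C : R, 0 < C & forall y z, V' y -> V' z -> `|g y - g z| <= C * `|y - z|].
Proof.
move=> oU Ux0 SF F0; have [DF _] := SF.
pose J := jacobian F x0.
have uJ : J \in unitmx.
  apply: unitmx_inj => v; rewrite -deriveEjacobian; [exact: F0|exact: DF].
pose A := invmx J.
have Ai (v : 'rV[R]_n) : v *m A = 0 -> v = 0.
  by move=> /(congr1 (mulmxr J)); rewrite /= mulmxKV // mul0mx.
pose E := newton F A.
have E0 v : 'D_v E x0 = 0.
  by rewrite derive_newton ?deriveEjacobian ?mulmxK ?subrr //; exact: DF.
have [r r0 [rU HDE HE]] := contraction_ball oU Ux0 (Dk_newton A oU SF) E0.
have [C C0 HC] := linear_rV_bounded (mulmxr A : {linear 'rV[R]_n -> _}).
pose s := r / 2.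
have sE : s = 2^-1 * r by rewrite /s mulrC.
have sr : s < r by lra.
have s0 : 0 < s by lra.
pose K := closed_ball_ (fun x : 'rV[R]_n => `|x|) x0 s.
have Kr x : K x -> ball x0 r x.
  by rewrite /K /closed_ball_ -ball_normE /= => xs; exact: le_lt_trans sr.
have bK x : ball x0 s x -> K x by rewrite /K /closed_ball_ -ball_normE => /ltW.
(* On the closed ball of radius s = r / 2, E moves points at most s / 2 away from E x0; the
   remaining s / 2 = r / 4, taken strictly, keeps the fixed point in the open ball. *)
pose V' := [set y : 'rV[R]_n | `|(y - F x0) *m A| < r / 4].
have Kx0 : K x0 by rewrite /K /closed_ball_ /= subrr normr0 ltW.
have oV : open V'.
  have cf : continuous (fun y : 'rV[R]_n => (y - F x0) *m A).
    move=> y; apply: differentiable_continuous; apply: differentiable_mulmxr.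
    by apply: differentiableB => //; exact: differentiable_cst.
  have -> : V' = (fun y : 'rV[R]_n => (y - F x0) *m A) @^-1` ball 0 (r / 4).
    by apply/funext => y; rewrite /V' -ball_normE /= sub0r normrN.
  by apply: open_comp => [y _|]; [exact: cf|exact: ball_open].
have fixp y : V' y -> exists2 x, ball x0 s x & F x = y.
  move=> Vy; pose T x := E x + y *m A.
  have TE x z : T x - T z = E x - E z by rewrite /T opprD addrACA subrr addr0.
  have Tx0 x : K x -> `|x0 - T x| < s.
    move=> Kx.
    have -> : x0 - T x = (E x0 - E x) - (y - F x0) *m A.
      rewrite /T /E /newton mulmxBl; apply/matrixP => i j; rewrite !mxE; ring.
    rewrite (le_lt_trans (ler_normB _ _)) //.
    have := HE x x0 (Kr x Kx) (Kr x0 Kx0).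
    have := Kx; rewrite /K /closed_ball_ /= => Hx.
    move: Vy; rewrite /V' /=; lra.
  have [|||x Kx Tx] := @contraction_fixpoint _ n T x0 s.
  - exact: ltW.
  - by move=> x Kx; rewrite /closed_ball_ /= ltW // Tx0.
  - by move=> x z Kx Kz; rewrite TE HE //; exact: Kr.
  exists x; first by rewrite -ball_normE /= -[in X in X < _]Tx; exact: Tx0.
  apply: (newton_inj Ai); rewrite -/(E x) -[in RHS]Tx /T.
  by rewrite addrK.
(* x - z = (E x - E z) + (F x - F z) A, and the first term is absorbed since it is at most half of
   |x - z|. This yields both uniqueness of preimages and the Lipschitz constant. *)
have lip x z : ball x0 s x -> ball x0 s z -> `|x - z| <= 2 * C * `|F x - F z|.
  move=> /bK/Kr xr /bK/Kr zr.
  have := HE z x zr xr; have := HC (F x - F z).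
  have : `|x - z| <= `|E x - E z| + `|(F x - F z) *m A|.
    apply: le_trans (ler_normD _ _).
    suff -> : x - z = E x - E z + (F x - F z) *m A by [].
    rewrite /E /newton mulmxBl; apply/matrixP => i j; rewrite !mxE; ring.
  rewrite /=; lra.
pose U' := [set x | ball x0 s x /\ V' (F x)].
pose g y := xget x0 [set x | ball x0 s x /\ F x = y].
have gP y : V' y -> ball x0 s (g y) /\ F (g y) = y.
  by move=> /fixp[x xs Fx]; apply: (@xgetPex _ x0 [set x | ball x0 s x /\ F x = y]); exists x.
exists U', V', g; split; split => //.
- rewrite openE => x [xs Vx]; apply: filterI.
    by apply: open_nbhs_nbhs; split=> //; exact: ball_open.
  have cF : {for x, continuous F}.
    by apply: differentiable_continuous; apply: DF; apply/rU/Kr/bK.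
  by apply: cF; exact: open_nbhs_nbhs.
- split; first exact: ballxx.
  by rewrite /V' /= subrr mul0mx normr0 divr_gt0.
- by move=> x [/bK/Kr/rU].
- move=> x [xs Vx]; split=> //.
  have [gs Fg] := gP _ Vx.
  apply/eqP; rewrite -subr_eq0 -normr_le0.
  by have := lip _ _ gs xs; rewrite Fg subrr normr0 mulr0.
- by move=> y Vy; have [gs Fg] := gP _ Vy; split=> //; split=> //; rewrite Fg.
(* If F has zero derivative along v, then E has derivative v there, although its norm is at most |v|
   / 2. *)
- move=> x v [/bK/Kr xr _] Fv.
  have := HDE x v xr; rewrite derive_newton; last by apply: DF; exact: rU.
  rewrite Fv mul0mx subr0 => H.
  by apply/eqP; rewrite -normr_le0; lra.
- exists (2 * C); first lra.
  move=> y z /gP[gy Fy] /gP[gz Fz]; have := lip _ _ gy gz.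
  by rewrite Fy Fz.
Qed.

(** The expansion of F at g y has an error small against g (y + h) - g y; the Lipschitz bound makes
    it small against h. The constants C and D account for this bound and for the norm of the inverse
    Jacobian. *)
Lemma differentiable_local_inverse n (F g : 'rV[R]_n -> 'rV[R]_n) V' y (C : R) :
  open V' -> V' y -> differentiable F (g y) -> jacobian F (g y) \in unitmx ->
  0 < C -> (forall z, V' z -> F (g z) = z) ->
  (forall z, V' z -> `|g z - g y| <= C * `|z - y|) ->
  is_diff y g (mulmxr (invmx (jacobian F (g y)))).
Proof.
move=> oV Vy dF uJ C0 Fg lip; set J := jacobian F (g y) in uJ *.
apply: is_diff_eps => [|e e0]; first exact: linear_rV_continuous.
have [D D0 HD] := linear_rV_bounded (mulmxr (invmx J) : {linear 'rV[R]_n -> _}).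
have CD0 : 0 < C * D by rewrite mulr_gt0.
have /nbhs_ballP[r /= r0 Hr] := diff_epsP dF (divr_gt0 e0 CD0).
have nV : \forall h \near (0 : 'rV[R]_n), V' (h + y).
  have /nbhs_ballP[q q0 qV] := open_nbhs_nbhs (conj oV Vy).
  apply/nbhs_ballP; exists q => // h; rewrite -ball_normE /= => hq; apply: qV.
  by rewrite -ball_normE /= opprD addrCA subrr addr0 -[- h]add0r.
have nr : \forall h \near (0 : 'rV[R]_n), C * `|h| < r.
  apply/nbhs_ballP; exists (r / C); first by rewrite /= divr_gt0.
  by move=> h; rewrite -ball_normE /= sub0r normrN ltr_pdivlMr // mulrC.
near=> h.
have Vh : V' (h + y) by near: h.
have lh : `|g (h + y) - g y| <= C * `|h| by have := lip _ Vh; rewrite addrK.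
have rh : C * `|h| < r by near: h.
have H : `|h - (g (h + y) - g y) *m J| <= e / (C * D) * `|g (h + y) - g y|.
  rewrite /J /jacobian mul_rV_lin1.
  have := Hr (g (h + y) - g y); rewrite subrK !Fg // addrK; apply.
  by rewrite -ball_normE /= sub0r normrN (le_lt_trans lh).
have -> : g (h + y) - g y - mulmxr (invmx J) h =
    - mulmxr (invmx J) (h - (g (h + y) - g y) *m J).
  by rewrite /= mulmxBl mulmxK // opprB.
rewrite normrN; apply: le_trans (HD _) _; apply: le_trans (ler_wpM2l (ltW D0) H) _.
have -> : e * `|h| = D * (e / (C * D) * (C * `|h|)) by field; rewrite !gt_eqF.
apply: (ler_wpM2l (ltW D0)); apply: ler_wpM2l => //.
by rewrite ltW // divr_gt0.
Unshelve. all: by end_near. Qed.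

(** Bootstrap: the derivative of g is the inverse Jacobian of F composed with g, so it is as regular
    as g already is. *)
Theorem inverse_function n (F : 'rV[R]_n -> 'rV[R]_n) U x0 :
  open U -> U x0 -> (forall k, Dk k U F) -> (forall v, 'D_v F x0 = 0 -> v = 0) ->
  exists (U' V' : set 'rV[R]_n) (g : 'rV[R]_n -> 'rV[R]_n),
    [/\ open U', U' x0 & U' `<=` U] /\
    [/\ open V',
        forall x, U' x -> V' (F x) /\ g (F x) = x,
        forall y, V' y -> U' (g y) /\ F (g y) = y &
        forall k, Dk k V' g].
Proof.
move=> oU Ux0 SF F0.
have [U' [V' [g [[oU' U'x0 U'U] [oV gF Fg Finj [C C0 lip]]]]]] :=
  local_inverse oU Ux0 (SF 1%N) F0.
exists U', V', g; split; split=> //.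
have DF x : U' x -> differentiable F x by move=> /U'U; exact: (Dk_diff (SF 0%N)).
have uJ x : U' x -> jacobian F x \in unitmx.
  move=> Ux; apply: unitmx_inj => v; rewrite -deriveEjacobian; last exact: DF.
  exact: Finj.
have Dg y : V' y -> is_diff y g (mulmxr (invmx (jacobian F (g y)))).
  move=> Vy; have [Ugy Fgy] := Fg y Vy.
  apply: (differentiable_local_inverse (C := C) oV) => //; [exact: DF|exact: uJ| |].
    by move=> z /Fg[].
  by move=> z Vz; exact: lip.
elim=> [|k IH]; first by split=> // y /Dg[].
split=> [y /Dg[] //|v].
have SJ (i j : 'I_n) : Dk k V' (fun y => jacobian F (g y) i j).
  have SFij : Dk k U' (fun x => ('D_(delta_mx 0 i) F x) 0 j).
    apply: Dk_entry => //; apply: (Dk_sub U'U).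
    by have [_] := SF k.+1; exact.
  apply: Dk_ext (Dk_comp oV _ SFij IH) => // [y Vy|y /Fg[]//].
  have [Ugy _] := Fg y Vy.
  by rewrite /= deriveEjacobian -?rowE ?mxE //; exact: DF.
have SI := Dk_invmx oV (fun y Vy => uJ _ (Fg y Vy).1) SJ.
apply: Dk_rV => // j.
have S : Dk k V' (fun y => \sum_i v 0 i * invmx (jacobian F (g y)) i j).
  by apply: Dk_sum => // i _; apply: (@DkM _ _ _ _ (fun=> _)) => //; exact: Dk_cst.
apply: Dk_ext S => // y /Dg[dg dE].
by rewrite deriveE // dE /= mxE.
Qed.

End Inverse_function_theorem.

(** * Permutations compatible with a chain of subsets *)

Section Permutation_chains.
Variable c : nat.
Implicit Types (S T G : {set 'I_c}) (tau : 'S_c) (C : pred {set 'I_c}).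

Definition tri (k : nat) : nat := 'C(k.+1, 2).

Lemma triS k : tri k.+1 = (tri k + k.+1)%N.
Proof. by rewrite /tri binS bin1 addnC. Qed.

Lemma tri_double k : (tri k * 2 = k * k.+1)%N.
Proof. by elim: k => // k IH; rewrite triS mulnDl IH; lia. Qed.

(** Supermodularity in disguise: k, a, b will be the sizes of an intersection and of the two
    differences. *)
Lemma tri_strict_convex a b k : (0 < a)%N -> (0 < b)%N ->
  (tri (k + a) + tri (k + b) < tri (k + a + b) + tri k)%N.
Proof.
move=> a0 b0.
have := tri_double (k + a); have := tri_double (k + b).
have := tri_double (k + a + b); have := tri_double k; nia.
Qed.

(** Slack of the vertex [perm_point R tau] at the facet of S, written as a number of inversions so
    that it can serve as an exponent. *)
Definition excess tau S : nat :=
  \sum_(i in S) \sum_(j | j \notin S) (tau j < tau i).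

Lemma sum_perm_excess tau S :
  (\sum_(i in S) (tau i).+1 = tri #|S| + excess tau S)%N.
Proof.
have H i : (\sum_(j < c) (tau j <= tau i) = (tau i).+1)%N.
  rewrite (reindex_inj (@perm_inj _ tau^-1%g)) /=.
  under eq_bigr do rewrite permKV.
  rewrite -(big_mkord xpredT (fun j => (j <= tau i : nat)))%N.
  rewrite (big_cat_nat (n := (tau i).+1)) //=.
  rewrite (eq_big_nat _ _ (F2 := fun=> 1%N)); last first.
    by move=> j; rewrite ltnS => /andP[_ ->].
  rewrite sum_nat_const_nat muln1 subn0 (eq_big_nat _ _ (F2 := fun=> 0%N)).
    by rewrite sum_nat_const_nat muln0 addn0.
  by move=> j /andP[+ _]; rewrite ltnNge => /negPf ->.
under eq_bigr do rewrite -H (bigID (mem S)) /=.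
rewrite big_split /=; congr (_ + _)%N; last first.
  apply: eq_bigr => i iS; apply: eq_bigr => j jS.
  rewrite leq_eqVlt; case: eqVneq => //= /val_inj/perm_inj ji.
  by rewrite ji iS in jS.
(* Pairs inside S: adding the sum with i and j exchanged, each i counts every j of S once and itself
   twice. *)
apply/eqP; rewrite -(eqn_pmul2r (isT : 0 < 2)%N) tri_double muln2 -addnn.
rewrite {2}exchange_big /= -big_split /=.
rewrite (eq_bigr (fun i => #|S| + 1)%N); first by rewrite sum_nat_const addn1.
move=> i iS; rewrite -big_split /= (bigD1 i) //= leqnn.
rewrite (eq_bigr (fun=> 1%N)); last first.
  move=> j /andP[jS ji]; case: ltngtP => // /val_inj/perm_inj E.
  by rewrite E eqxx in ji.
rewrite -[in RHS]sum1_card [in RHS](bigD1 i) //=.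
by rewrite addnAC.
Qed.

Lemma excess_eq0P tau S :
  reflect (forall i j, i \in S -> j \notin S -> (tau i < tau j)%N) (excess tau S == 0%N).
Proof.
rewrite sum_nat_eq0; apply: (iffP forall_inP) => H i.
  move=> j iS jS; have := H i iS; rewrite sum_nat_eq0 => /forall_inP/(_ j jS).
  rewrite eqb0 -leqNgt leq_eqVlt => /orP[/eqP/val_inj/perm_inj E|//].
  by rewrite -E iS in jS.
move=> iS; rewrite sum_nat_eq0; apply/forall_inP => j jS.
by rewrite eqb0 -leqNgt ltnW ?H.
Qed.

Definition chain C := forall S T, C S -> C T -> (S \subset T) || (T \subset S).

(** The vertex of tau lies on all the facets in C. *)
Definition compatible C tau := forall S, C S -> excess tau S = 0%N.

Lemma perm_of_key (key : 'I_c -> nat) : injective key ->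
  exists tau, forall i j, (tau i < tau j)%N = (key i < key j)%N.
Proof.
move=> key_inj; pose r i := #|[pred j | (key j < key i)%N]|.
have r_lt i j : (key i < key j)%N -> (r i < r j)%N.
  move=> ij; apply: proper_card; apply/properP; split.
    by apply/fintype.subsetP => k; rewrite !inE => /ltn_trans; exact.
  by exists i; rewrite !inE // ltnn.
have rc i : (r i < c)%N.
  rewrite -[X in (_ < X)%N]card_ord; apply: proper_card; apply/properP; split.
    exact: subset_predT.
  by exists i; rewrite !inE // ltnn.
have rI : injective (fun i => Ordinal (rc i)).
  move=> i j /(congr1 val) /= E; apply: key_inj.
  by case: (ltngtP (key i) (key j)) => // /r_lt; rewrite E ltnn.
exists (perm rI) => i j; rewrite !permE /=.
apply/idP/idP => [|/r_lt//]; apply: contraTT; rewrite -!leqNgt leq_eqVlt.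
by case/orP => [/eqP/key_inj->//|/r_lt/ltnW].
Qed.

(** For a chain C, the position of the block of i among the successive differences of C. *)
Definition depth C (i : 'I_c) : nat := #|[pred S | C S & i \notin S]|.

Lemma depth_lt C S i j : chain C -> C S -> i \in S -> j \notin S ->
  (depth C i < depth C j)%N.
Proof.
move=> chC CS iS jS; apply: proper_card; apply/properP; split.
  apply/fintype.subsetP => T; rewrite !inE => /andP[CT iT]; rewrite CT /=.
  have /orP[/fintype.subsetP ST|/fintype.subsetP TS] := chC _ _ CS CT.
    by rewrite ST in iT.
  by apply: contra jS; exact: TS.
by exists S; rewrite !inE ?CS ?iS.
Qed.

Lemma depth_sep C i j : (depth C i < depth C j)%N ->
  exists S, [/\ C S, i \in S & j \notin S].
Proof.
move=> ij; have : ~~ ([pred S | C S & j \notin S] \subset [pred S | C S & i \notin S]).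
  by apply: contraL ij => /subset_leq_card; rewrite -leqNgt.
move=> /fintype.subsetPn[S]; rewrite !inE => /andP[CS jS].
by rewrite CS /= negbK; exists S.
Qed.

(* Sorting by depth gives compatible permutations; the order inside the blocks is free. *)
Lemma compatible_tie C (tie : 'I_c -> nat) M : chain C ->
  injective tie -> (forall i, tie i < M)%N ->
  exists2 tau, compatible C tau &
    forall i j, (depth C i <= depth C j)%N -> (tie i < tie j)%N -> (tau i < tau j)%N.
Proof.
move=> chC tieI tieM.
(* Since ties are below M, this key orders lexicographically by depth, then tie. *)
have kI : injective (fun i => depth C i * M + tie i)%N.
  move=> i j E; apply: tieI; have := tieM i; have := tieM j.
  by case: (ltngtP (depth C i) (depth C j)) => ij; nia.
have [tau tauE] := perm_of_key kI.
exists tau => [S CS|i j ij tij]; last by rewrite tauE; nia.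
apply/eqP/excess_eq0P => i j iS jS; rewrite tauE.
have := depth_lt chC CS iS jS; have := tieM i; have := tieM j; nia.
Qed.

Lemma compatible_exists C : chain C -> exists tau, compatible C tau.
Proof.
move=> chC; have [tau ? _] := compatible_tie chC (@ord_inj c) (@ltn_ord c).
by exists tau.
Qed.

(** The face of a chain lies on no further facet. Within each block the elements of G are placed
    last; if G still came first as a whole, depth would separate it from its complement, and G would
    be a member of the chain. *)
Lemma compatible_avoid C G : chain C -> C finset.set0 -> C finset.setT -> ~~ C G ->
  exists2 tau, compatible C tau & (0 < excess tau G)%N.
Proof.
move=> chC C0 CT nCG.
pose tie (i : 'I_c) := (i + (i \in G) * c)%N.
have tieI : injective tie.
  by move=> i j; rewrite /tie => E; apply: val_inj; have := ltn_ord i; have := ltn_ord j;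
    move: E; case: (i \in G); case: (j \in G) => /=; lia.
have tieM i : (tie i < 2 * c)%N.
  by rewrite /tie; have := ltn_ord i; case: (i \in G) => /=; lia.
have [tau tauC tauE] := compatible_tie chC tieI tieM.
exists tau => //; rewrite lt0n; apply/negP => /excess_eq0P tauG.
have sepG i j : i \in G -> j \notin G -> (depth C i < depth C j)%N.
  move=> iG jG; rewrite ltnNge; apply/negP => ji.
  have := tauG i j iG jG; rewrite ltnNge ltnW // tauE // /tie iG (negPf jG).
  by have := ltn_ord j; lia.
have [i0 i0G] : exists i, i \in G.
  by apply/set0Pn; apply: contra nCG => /eqP ->.
have [j0 j0G] : exists j, j \notin G.
  have : ~~ (finset.setT \subset G) by apply: contra nCG; rewrite finset.subTset => /eqP ->.
  by move=> /fintype.subsetPn[j _ jG]; exists j.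
(* A member of C separating the deepest element of G from the shallowest one outside must be G
   itself. *)
have [i iG imax] := arg_maxnP (P := fun k => k \in G) (depth C) i0G.
have [j jG jmin] := arg_minnP (P := fun k => k \notin G) (depth C) j0G.
have [S [CS iS jS]] := depth_sep (sepG i j iG jG).
move/negP : nCG; apply; suff -> : G = S by [].
apply/setP => k; apply/idP/idP => [kG|kS].
  apply/negPn/negP => /(depth_lt chC CS iS).
  by have /= := imax k kG; rewrite leqNgt => /negPf ->.
apply/negPn/negP => kG.
have := depth_lt chC CS kS jS.
by have /= := jmin k kG; rewrite leqNgt => /negPf ->.
Qed.

Lemma excess_tperm tau S i j : (i \in S) = (j \in S) ->
  excess (tperm i j * tau)%g S = excess tau S.
Proof.
move=> ij; apply/eqP; rewrite -(eqn_add2l (tri #|S|)) -!sum_perm_excess; apply/eqP.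
rewrite [RHS](reindex_inj (@perm_inj _ (tperm i j))) /=.
by apply: eq_big => [k|k _]; [case: tpermP => // ->|rewrite permM].
Qed.

(* Smoothness of the normal fan: compatible tau can be moved off one facet to height exactly 1. *)
Lemma excess_adjacent C G : chain C -> C G ->
  G != finset.set0 -> G != finset.setT ->
  exists2 tau, excess tau G = 1%N &
    forall S, C S -> S != G -> excess tau S = 0%N.
Proof.
move=> chC CG /set0Pn[i1 i1G] GT.
have [tau tauC] := compatible_exists chC.
have tau0 S i j : C S -> i \in S -> j \notin S -> (tau i < tau j)%N.
  by move=> /tauC/eqP/excess_eq0P; exact.
(* i has the last value used in G and j the next one, outside G. Exchanging them creates a single
   inversion across G, while every other member of C contains both or neither. *)
have [i iG imax] := arg_maxnP (P := fun k => k \in G) (fun i => val (tau i)) i1G.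
have [j1 j1G] : exists j, j \notin G.
  have : ~~ (finset.setT \subset G) by rewrite finset.subTset.
  by move=> /fintype.subsetPn[j _ jG]; exists j.
have ij1 := tau0 G i j1 CG iG j1G.
have lt_c : ((tau i).+1 < c)%N by rewrite (leq_ltn_trans ij1).
pose j := (tau^-1)%g (Ordinal lt_c).
have tauj : tau j = (tau i).+1 :> nat by rewrite /j permKV.
have jG : j \notin G by apply/negP => /imax /=; rewrite tauj ltnn.
have out s : s \notin G -> (tau j <= tau s)%N by rewrite tauj; exact: tau0.
exists (tperm i j * tau)%g.
  have := sum_perm_excess (tperm i j * tau)%g G.
  have := sum_perm_excess tau G; rewrite (tauC _ CG) addn0 => <-.
  rewrite !(bigD1 i iG) /= permM tpermL tauj.
  rewrite (eq_bigr (fun k : 'I_c => (tau k).+1)).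
    by rewrite -addnA -addn1 -addnA => /addnI; rewrite addnC => /addnI <-.
  move=> k /andP[kG ki]; rewrite permM tpermD // 1?eq_sym //.
  by apply: contraNneq jG => <-.
move=> S CS SG; rewrite excess_tperm; first exact: tauC.
have /orP[SsubG|GsubS] := chC _ _ CS CG.
  have /properP[_ [g gG gS]] : S \proper G by rewrite finset.properEneq SG.
  rewrite (negPf (contra (fintype.subsetP SsubG j) jG)).
  apply/negP => iS; have := tau0 _ _ _ CS iS gS.
  by have /= := imax g gG; rewrite leqNgt => /negPf ->.
have /properP[_ [s sS sG]] : G \proper S by rewrite finset.properEneq eq_sym SG.
rewrite (fintype.subsetP GsubS i iG); apply/esym/negPn/negP => jS.
by have := tau0 _ _ _ CS sS jS; rewrite ltnNge out.
Qed.
End Permutation_chains.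

(** * Coordinate sums over subsets *)

Section Subset_sums.
Context {R : realType} {c : nat}.
Implicit Types (x y z v : 'rV[R]_c) (S T G : {set 'I_c}) (tau : 'S_c)
  (C : pred {set 'I_c}).

Definition ssum x S : R := \sum_(i in S) x 0 i.

Lemma ssumD x y S : ssum (x + y) S = ssum x S + ssum y S.
Proof. by rewrite /ssum -big_split; apply: eq_bigr => i _; rewrite mxE. Qed.

Lemma ssumZ (a : R) x S : ssum (a *: x) S = a * ssum x S.
Proof. by rewrite /ssum mulr_sumr; apply: eq_bigr => i _; rewrite mxE. Qed.

Lemma ssumB x y S : ssum (x - y) S = ssum x S - ssum y S.
Proof. by rewrite -scaleN1r ssumD ssumZ mulN1r. Qed.

Lemma ssum_sum (I : finType) (F : I -> 'rV[R]_c) S :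
  ssum (\sum_i F i) S = \sum_i ssum (F i) S.
Proof.
rewrite /ssum exchange_big; apply: eq_bigr => i _.
by rewrite summxE.
Qed.

Lemma ssum0 x : ssum x finset.set0 = 0.
Proof. by rewrite /ssum big_set0. Qed.

Lemma ssumUI x S T : ssum x (S :|: T) + ssum x (S :&: T) = ssum x S + ssum x T.
Proof.
rewrite /ssum (big_setID S) /= [X in _ = _ + X](big_setID S) /=.
rewrite (finset.setIidPr (finset.subsetUl S T)) finset.setDUl finset.setDv finset.set0U.
by rewrite addrAC [T :&: S]finset.setIC -addrA.
Qed.

Lemma ssum_eq0 x : (forall S, ssum x S = 0) -> x = 0.
Proof.
move=> H; apply/matrixP => i j; rewrite (ord1 i) mxE.
by have := H [set j]%SET; rewrite /ssum big_set1.
Qed.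

Lemma ssum_perm_point tau S :
  ssum (perm_point R tau) S = (tri #|S| + excess tau S)%:R.
Proof.
rewrite -sum_perm_excess natr_sum; apply: eq_bigr => i _; by rewrite mxE.
Qed.

Lemma sum_ssum (a : {set 'I_c} -> R) z :
  \sum_S a S * ssum z S = \sum_i (\sum_(S : {set 'I_c} | i \in S) a S) * z 0 i.
Proof.
under [RHS]eq_bigr do rewrite mulr_suml.
rewrite (exchange_big_dep xpredT) //=; apply: eq_bigr => S _.
by rewrite mulr_sumr.
Qed.

(* Swapping two labels of the same block of C shows that sum_S a_S 1_S is constant on blocks. *)
Lemma chain_rigidity C (a : {set 'I_c} -> R) (h : R) z :
  chain C -> C finset.set0 -> C finset.setT ->
  (forall tau, compatible C tau -> \sum_S a S * (excess tau S)%:R = h) ->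
  (forall S, C S -> ssum z S = 0) ->
  \sum_S a S * ssum z S = 0.
Proof.
move=> chC C0 CT ah z0; rewrite sum_ssum.
pose u (i : 'I_c) := \sum_(S : {set 'I_c} | i \in S) a S; rewrite -/u.
have uE i j : (forall S, C S -> (i \in S) = (j \in S)) -> u i = u j.
  move=> ij; have [->//|nij] := eqVneq i j.
  have [tau tauC] := compatible_exists chC.
  have tau'C : compatible C (tperm i j * tau)%g.
    by move=> S CS; rewrite excess_tperm ?ij // tauC.
  have := ah _ tauC; rewrite -(ah _ tau'C) => /eqP; rewrite -subr_eq0 -sumrB.
  rewrite (eq_bigr (fun S => a S *
    ssum (perm_point R tau - perm_point R (tperm i j * tau)%g) S)); last first.
    by move=> S _; rewrite ssumB !ssum_perm_point !natrD opprD addrACA subrr add0r mulrBr.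
  rewrite sum_ssum (bigD1 i) //= (bigD1 j) /=; last by rewrite eq_sym.
  rewrite [X in _ + (_ + X)]big1 ?addr0; last first.
        move=> k /andP[ki kj]; rewrite !mxE permM tpermD 1?eq_sym // subrr mulr0 //.
  rewrite !mxE !permM tpermL tpermR -/(u i) -/(u j).
  set p := _.+1%:R; set q := _.+1%:R => /eqP E.
  have pq : p - q != 0.
    rewrite subr_eq0 eqr_nat eqSS; apply: contra nij => /eqP/val_inj/perm_inj->//.
  have : (u i - u j) * (p - q) = 0 by rewrite -E; ring.
  by move=> /eqP; rewrite mulf_eq0 (negPf pq) orbF subr_eq0 => /eqP.
suff H m S : C S -> (#|S| < m)%N -> \sum_(i in S) u i * z 0 i = 0.
  have := H #|finset.setT|.+1 _ CT (leqnn _).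
  by under eq_bigl do rewrite finset.in_setT.
elim: m S => // m IH S CS Sm.
have [->|/set0Pn[s sS]] := eqVneq S finset.set0; first by rewrite big_set0.
have P0 : C finset.set0 && (finset.set0 \proper S).
  by rewrite C0 finset.proper0; apply/set0Pn; exists s.
(* T is the predecessor of S in the chain, so S minus T is a block: u is constant on it and z sums
   to 0 over it. *)
have [T /andP[CT' TS] Tmax] := arg_maxnP (P := fun T => C T && (T \proper S)) (fun T => #|T|) P0.
rewrite (big_setID T) /= (finset.setIidPr (proper_sub TS)) IH //; last first.
  exact: leq_trans (proper_card TS) _.
have /properP[_ [i0 i0S i0T]] := TS.
rewrite (eq_bigr (fun i => u i0 * z 0 i)); last first.
  move=> i; rewrite finset.in_setD => /andP[iT iS]; congr (_ * _); apply: uE => T' CT''.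
  have /orP[T'S|ST'] := chC _ _ CT'' CS; last by rewrite !(fintype.subsetP ST').
  have [->|nT'S] := eqVneq T' S; first by rewrite iS i0S.
  have T'pS : T' \proper S by rewrite finset.properEneq nT'S.
  have cT' := Tmax T'; rewrite CT'' T'pS /= in cT'.
  have T'T : T' \subset T.
    have /orP[//|TT'] := chC _ _ CT'' CT'.
    have /eqP<- : T == T' by rewrite eqEcard TT' cT'.
    exact: subxx.
  rewrite (negPf (contra (fintype.subsetP T'T i) iT)).
  by rewrite (negPf (contra (fintype.subsetP T'T i0) i0T)).
rewrite -mulr_sumr add0r.
have := z0 _ CS; rewrite /ssum (big_setID T) /= (finset.setIidPr (proper_sub TS)).
by have := z0 _ CT'; rewrite /ssum => ->; rewrite add0r => ->; rewrite mulr0.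
Qed.
End Subset_sums.

(** * The toric map *)

Section Polytope_map.
Context {R : realType} {c : nat}.
Implicit Types (x y z v : 'rV[R]_c) (S T G : {set 'I_c}) (tau : 'S_c).

(** The base polytope of f, also known as the core of a convex game when f is supermodular. *)
Definition gen_permutohedron (f : {set 'I_c} -> R) : set 'rV[R]_c :=
  [set x | (forall S, f S <= ssum x S) /\ ssum x finset.setT = f finset.setT].

Definition strict_supermodular (f : {set 'I_c} -> R) := forall S T,
  ~~ (S \subset T) -> ~~ (T \subset S) -> f S + f T < f (S :|: T) + f (S :&: T).

Definition std (S : {set 'I_c}) : R := (tri #|S|)%:R.

Variable f : {set 'I_c} -> R.
Hypothesis f0 : f finset.set0 = 0.
Hypothesis f_smod : strict_supermodular f.

Definition slack x S := ssum x S - f S.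
Definition active x : pred {set 'I_c} := fun S => slack x S == 0.
(** On the boundary, an active S contributes [0 ^+ 0 = 1] if tau lies on its facet and 0 otherwise.
    The empty and full sets always have excess 0. *)
Definition mono x tau : R := \prod_S slack x S ^+ excess tau S.
Definition den x : R := \sum_tau mono x tau.

(* The moment map of the standard permutohedron composed with the gradient of
   the symplectic potential sum_S l_S ln l_S, where l_S is the slack of S: in
   these terms the weight of the vertex tau is exp (sum_S (ln l_S) * excess tau S).
   The last summand vanishes on the polytope; it makes the map a local
   diffeomorphism of the whole space. *)
Definition toric_map x : 'rV[R]_c :=
  \sum_tau (mono x tau / den x) *: perm_point R tau + const_mx (slack x finset.setT).

Local Notation P := (gen_permutohedron f).
Local Notation Phi := toric_map.

Lemma ssum_const (a : R) S : ssum (const_mx a) S = #|S|%:R * a.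
Proof.
rewrite /ssum (eq_bigr (fun=> a)) => [|i _]; last by rewrite mxE.
by rewrite sumr_const mulr_natl.
Qed.

Lemma slack_ge0 x S : P x -> 0 <= slack x S.
Proof. by case=> H _; rewrite subr_ge0. Qed.

Lemma slackT x : P x -> slack x finset.setT = 0.
Proof. by case=> _ H; rewrite /slack H subrr. Qed.

Lemma active0 x : active x finset.set0.
Proof. by rewrite /active /slack ssum0 f0 subrr. Qed.

Lemma activeT x : P x -> active x finset.setT.
Proof. by move=> Px; rewrite /active slackT. Qed.

(** [ssum x] is modular, so two incomparable tight sets would contradict the strict supermodularity
    of f. *)
Lemma active_chain x : P x -> chain (active x).
Proof.
move=> Px S T /eqP/subr0_eq HS /eqP/subr0_eq HT.
apply/negPn/negP; rewrite negb_or => /andP[nST nTS].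
have := f_smod nST nTS; rewrite -HS -HT -ssumUI ltNge => /negP; apply.
by case: Px => H _; exact: lerD.
Qed.

Lemma mono_neq0 x tau : (mono x tau != 0) <-> compatible (active x) tau.
Proof.
rewrite /mono; split=> [/prodf_neq0 H S|H].
  have := H S isT; rewrite expf_eq0 negb_and lt0n negbK => /orP[/eqP//|+ aS].
  by rewrite -/(active x S) aS.
apply/prodf_neq0 => S _; rewrite expf_eq0 negb_and lt0n negbK.
have [aS|/negPf naS] := boolP (active x S); first by rewrite H.
by rewrite -/(active x S) naS orbT.
Qed.

Lemma mono_ge0 x tau : P x -> 0 <= mono x tau.
Proof. by move=> Px; apply: prodr_ge0 => S _; rewrite exprn_ge0 ?slack_ge0. Qed.

Lemma mono_gt0 x tau : P x -> compatible (active x) tau -> 0 < mono x tau.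
Proof. by move=> Px H; rewrite lt0r mono_ge0 // andbT; exact/mono_neq0. Qed.

Lemma mono_eq0 x tau S : active x S -> (0 < excess tau S)%N -> mono x tau = 0.
Proof.
move=> aS tS; apply/eqP/negPn/negP => /mono_neq0/(_ _ aS) E.
by rewrite E in tS.
Qed.

Lemma den_gt0 x : P x -> 0 < den x.
Proof.
move=> Px; have [tau tauC] := compatible_exists (active_chain Px).
rewrite /den (bigD1 tau) //= ltr_pwDl ?mono_gt0 // sumr_ge0 // => t _.
exact: mono_ge0.
Qed.

Lemma ssum_toric_map x S : den x != 0 -> ssum (Phi x) S =
  std S + (\sum_tau mono x tau * (excess tau S)%:R) / den x
  + #|S|%:R * slack x finset.setT.
Proof.
move=> d0; rewrite /toric_map ssumD ssum_const; congr (_ + _).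
rewrite ssum_sum (eq_bigr (fun tau => mono x tau * (std S / den x) +
    mono x tau * (excess tau S)%:R / den x)) => [|tau _]; last first.
  by rewrite ssumZ ssum_perm_point natrD /std; ring.
rewrite big_split -!mulr_suml /= -/(den x) mulrCA.
by rewrite divff // mulr1.
Qed.

Lemma ssum_toric_map_gperm x S : P x -> ssum (Phi x) S =
  std S + (\sum_tau mono x tau * (excess tau S)%:R) / den x.
Proof.
by move=> Px; rewrite ssum_toric_map ?gt_eqF ?den_gt0 // slackT // mulr0 addr0.
Qed.

Lemma toric_map_weights x : P x -> exists w : 'S_c -> R,
  [/\ forall tau, 0 <= w tau, \sum_tau w tau = 1 &
      Phi x = \sum_tau w tau *: perm_point R tau].
Proof.
move=> Px; exists (fun tau => mono x tau / den x); split.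
- by move=> tau; rewrite divr_ge0 ?mono_ge0 // ltW ?den_gt0.
- by rewrite -mulr_suml divff // gt_eqF ?den_gt0.
- rewrite /toric_map slackT //; apply/matrixP => i j; rewrite !mxE.
  by rewrite addr0.
Qed.

Lemma excess_mean_ge0 x S : P x ->
  0 <= (\sum_tau mono x tau * (excess tau S)%:R) / den x.
Proof.
move=> Px; rewrite divr_ge0 ?(ltW (den_gt0 Px)) // sumr_ge0 // => tau _.
by rewrite mulr_ge0 ?mono_ge0.
Qed.

(** The slack of the image at S is a weighted mean of excesses. An active S kills every weight with
    positive excess; for an inactive S, [compatible_avoid] provides a positive term. *)
Lemma toric_map_active x S : P x -> (ssum (Phi x) S == std S) = active x S.
Proof.
move=> Px; rewrite ssum_toric_map_gperm // eq_sym addrC -subr_eq subrr eq_sym.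
rewrite mulf_eq0 invr_eq0 [den x == 0]gt_eqF ?den_gt0 // orbF.
apply/idP/idP => [|aS]; last first.
  rewrite big1 // => tau _; have [->|t0] := posnP (excess tau S); first by rewrite mulr0.
  by rewrite (mono_eq0 aS t0) mul0r.
apply: contraLR => naS.
have [tau tauC t0] := compatible_avoid (active_chain Px) (active0 x) (activeT Px) naS.
rewrite gt_eqF // (bigD1 tau) //= ltr_pwDl //.
  by rewrite mulr_gt0 ?mono_gt0 // ltr0n.
by rewrite sumr_ge0 // => t _; rewrite mulr_ge0 ?mono_ge0.
Qed.

Lemma toric_map_gperm x : P x -> gen_permutohedron std (Phi x).
Proof.
move=> Px; split=> [S|].
  by rewrite ssum_toric_map_gperm // lerDl excess_mean_ge0.
by apply/eqP; rewrite toric_map_active // activeT.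
Qed.

Lemma slack_inj x y : (forall S, slack x S = slack y S) -> x = y.
Proof.
move=> H; apply/subr0_eq/ssum_eq0 => S.
by rewrite ssumB; have /addIr -> := H S; rewrite subrr.
Qed.

Lemma ln_sub_mulP (a b : R) : 0 < a -> 0 < b ->
  0 <= (a - b) * (ln a - ln b) /\ ((a - b) * (ln a - ln b) = 0 -> a = b).
Proof.
move=> a0 b0; case: (ltgtP a b) => [ab|ba|->]; last by rewrite subrr mul0r.
  have H : ln a < ln b by rewrite ltr_ln.
  have {}H : 0 < (a - b) * (ln a - ln b) by rewrite nmulr_rgt0 subr_lt0.
  by split=> [|E]; [exact: ltW|rewrite E ltxx in H].
have H : ln b < ln a by rewrite ltr_ln.
have {}H : 0 < (a - b) * (ln a - ln b) by rewrite mulr_gt0 ?subr_gt0.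
by split=> [|E]; [exact: ltW|rewrite E ltxx in H].
Qed.

Lemma ln_prod (I : Type) (r : seq I) (F : I -> R) : (forall i, 0 < F i) ->
  ln (\prod_(i <- r) F i) = \sum_(i <- r) ln (F i).
Proof.
move=> F0; elim: r => [|i r IH]; first by rewrite !big_nil ln1.
by rewrite !big_cons lnM ?IH // posrE ?prodr_gt0.
Qed.

Lemma ln_mono x tau : P x -> compatible (active x) tau ->
  ln (mono x tau) = \sum_S ln (slack x S) * (excess tau S)%:R.
Proof.
move=> Px tauC.
have H S : 0 < slack x S ^+ excess tau S /\
    ln (slack x S ^+ excess tau S) = ln (slack x S) * (excess tau S)%:R.
  (* For active S the default value of ln at 0 is multiplied by an excess equal to 0. *)
  have [aS|naS] := boolP (active x S); first by rewrite tauC // expr0 ln1 mulr0.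
  have s0 : 0 < slack x S by rewrite lt0r naS slack_ge0.
  by rewrite exprn_gt0 // lnXn // mulr_natr.
rewrite /mono ln_prod; last by move=> S; have [] := H S.
by apply: eq_bigr => S _; have [_] := H S.
Qed.

(** Monotonicity of ln is used twice: over the vertices, to show that the weights at x and y agree,
    then over the subsets, to show that the slacks agree. [chain_rigidity] leads from one to the
    other. *)
Lemma toric_map_inj x y : P x -> P y -> Phi x = Phi y -> x = y.
Proof.
move=> Px Py E.
have aE S : active x S = active y S by rewrite -!toric_map_active // E.
pose d S := ln (slack x S) - ln (slack y S).
pose l x tau := mono x tau / den x.
have lE S : \sum_tau (l x tau - l y tau) * (excess tau S)%:R = 0.
  have := congr1 (ssum^~ S) E; rewrite /= !ssum_toric_map_gperm // => /addrI.
  rewrite !mulr_suml => /eqP; rewrite -subr_eq0 -sumrB => /eqP {2}<-.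
  by apply: eq_bigr => tau _; rewrite /l; ring.
have l1 : \sum_tau (l x tau - l y tau) = 0.
  by rewrite sumrB -!mulr_suml !divff ?subrr // gt_eqF ?den_gt0.
pose h tau := \sum_S d S * (excess tau S)%:R.
pose C := ln (den x) - ln (den y).
have Ceq tau : compatible (active x) tau -> compatible (active y) tau.
  by move=> tauC S; rewrite -aE; exact: tauC.
have l_gt0 z tau : P z -> compatible (active z) tau -> 0 < l z tau.
  by move=> Pz tauC; rewrite divr_gt0 ?mono_gt0 ?den_gt0.
have lnl tau : compatible (active x) tau -> ln (l x tau) - ln (l y tau) = h tau - C.
  move=> tauC; have tauC' := Ceq _ tauC.
  rewrite /l !ln_div ?posrE ?mono_gt0 ?den_gt0 // !ln_mono // /h.
  rewrite [in RHS](eq_bigr (fun S =>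
    ln (slack x S) * (excess tau S)%:R - ln (slack y S) * (excess tau S)%:R)).
    by rewrite sumrB /C; ring.
  by move=> S _; rewrite -mulrBl.
have Hle tau : 0 <= (l x tau - l y tau) * (h tau - C).
  have [tau0|/mono_neq0 tauC] := eqVneq (mono x tau) 0; last first.
    rewrite -lnl //; apply: (ln_sub_mulP _ _).1; first exact: l_gt0.
    by apply: l_gt0 => //; exact: Ceq.
  suff tau0' : mono y tau = 0 by rewrite /l tau0 tau0' !mul0r subrr mul0r.
  apply/eqP/negPn/negP => /mono_neq0 tauC; move/eqP : tau0; apply/negP/mono_neq0.
  by move=> S; rewrite aE; exact: tauC.
(* Equal images give equal mean excesses, and both families of weights sum to 1; so h - C, a
   combination of excesses and a constant, has the same mean for both. *)
have H0 : \sum_tau (l x tau - l y tau) * (h tau - C) = 0.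
  rewrite (eq_bigr (fun tau => \sum_S d S * ((l x tau - l y tau) * (excess tau S)%:R) -
    C * (l x tau - l y tau))); last first.
    move=> tau _; rewrite /h mulrBr mulr_sumr [C * _]mulrC; congr (_ - _).
    by apply: eq_bigr => S _; ring.
  rewrite sumrB -mulr_sumr l1 mulr0 subr0 exchange_big big1 //= => S _.
  by rewrite -mulr_sumr lE mulr0.
have hC tau : compatible (active x) tau -> h tau = C.
  move=> tauC; have Hz := psumr_eq0P (fun t _ => Hle t) H0; have := Hz tau isT.
  rewrite -lnl // => /(ln_sub_mulP (l_gt0 _ _ Px tauC) (l_gt0 _ _ Py (Ceq _ tauC))).2 lxy.
  by apply/subr0_eq; rewrite -lnl // lxy subrr.
have Z S : active x S -> ssum (x - y) S = 0.
  move=> aS; rewrite ssumB; have := aS; rewrite aE => /eqP/subr0_eq ->.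
  by move/eqP/subr0_eq : aS => ->; rewrite subrr.
(* The resulting sum consists of the products of the differences of slacks and of their logarithms,
   all nonnegative. *)
have := chain_rigidity (active_chain Px) (active0 x) (activeT Px) hC Z.
have dE S : d S * ssum (x - y) S = (slack x S - slack y S) * d S.
  by rewrite mulrC ssumB /slack; congr (_ * _); ring.
under eq_bigr do rewrite dE.
have dge S : 0 <= (slack x S - slack y S) * d S /\
    ((slack x S - slack y S) * d S = 0 -> slack x S = slack y S).
  have [aS|naS] := boolP (active x S).
    by have := aS; rewrite aE => /eqP ->; move/eqP : aS => ->; rewrite subrr mul0r.
  have naS' := naS; rewrite aE in naS'.
  by apply: ln_sub_mulP; rewrite lt0r slack_ge0 ?andbT.
move=> Hd; apply: slack_inj => S; apply: (dge S).2.
exact: (psumr_eq0P (fun t _ => (dge t).1) Hd).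
Qed.

Lemma scale_regular (a b : R) : a *: b = a * b. Proof. by []. Qed.

Lemma ssum_mulmx x S : ssum x S = (x *m \col_i (i \in S)%:R) 0 0.
Proof.
rewrite mxE /ssum big_mkcond; apply: eq_bigr => i _; rewrite mxE.
by case: (i \in S); rewrite ?mulr1 ?mulr0.
Qed.

Lemma differentiable_ssum n (F : 'rV[R]_n -> 'rV[R]_c) S (p : 'rV[R]_n) : differentiable F p ->
  differentiable (fun q => ssum (F q) S) p.
Proof.
move=> dF; under eq_fun do rewrite ssum_mulmx.
exact/differentiable_entry/differentiable_mulmxr.
Qed.

Lemma derive_ssum n (F : 'rV[R]_n -> 'rV[R]_c) S (p w : 'rV[R]_n) : differentiable F p ->
  'D_w (fun q => ssum (F q) S) p = ssum ('D_w F p) S.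
Proof.
move=> dF; under eq_fun do rewrite ssum_mulmx.
by rewrite derive_entry ?derive_mulmxr ?ssum_mulmx //; exact: differentiable_mulmxr.
Qed.

Lemma derive_prod (V : normedModType R) (I : eqType) (r : seq I) (F : I -> V -> R) (x v : V) :
  uniq r -> (forall i, differentiable (F i) x) ->
  differentiable (fun q => \prod_(i <- r) F i q) x /\
  'D_v (fun q => \prod_(i <- r) F i q) x =
    \sum_(i <- r) 'D_v (F i) x * \prod_(j <- r | j != i) F j x.
Proof.
move=> + dF; elim: r => [_|i r IH] /=.
  under eq_fun do rewrite big_nil; rewrite big_nil; split; first exact: differentiable_cst.
  exact: derive_cst.
move=> /andP[ir ur]; have [dr Er] := IH ur.
under eq_fun do rewrite big_cons.
split; first by apply: differentiableM.
rewrite deriveM; [|exact: diff_derivable..]; rewrite Er big_cons.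
rewrite addrC; congr (_ + _).
  rewrite big_cons eqxx /= scale_regular mulrC; congr (_ * _).
  rewrite [RHS]big_seq_cond [LHS]big_seq_cond; apply: eq_bigl => j.
  by rewrite andbT; case jr : (j \in r) => //=; apply/esym; apply: contraNneq ir => <-.
rewrite scaler_sumr [LHS]big_seq_cond [RHS]big_seq_cond; apply: eq_bigr => j /andP[jr _].
rewrite big_cons (_ : i != j); last by apply: contraNneq ir => ->.
by rewrite scale_regular mulrCA.
Qed.

Lemma derive_fsum (V W : normedModType R) (I : finType) (F : I -> V -> W) (p w : V) :
  (forall i, differentiable (F i) p) ->
  'D_w (fun q => \sum_i F i q) p = \sum_i 'D_w (F i) p.
Proof.
move=> dF.
suff H r : differentiable (fun q => \sum_(i <- r) F i q) p /\
    'D_w (fun q => \sum_(i <- r) F i q) p = \sum_(i <- r) 'D_w (F i) p by exact: (H _).2.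
elim: r => [|i r [dr Er]].
  under eq_fun do rewrite big_nil; rewrite big_nil; split; first exact: differentiable_cst.
  exact: derive_cst.
under eq_fun do rewrite big_cons.
split; first exact: differentiableD.
by rewrite deriveD ?Er ?big_cons //; exact: diff_derivable.
Qed.

Lemma differentiable_slack S x : differentiable (fun y => slack y S) x.
Proof.
apply: differentiableB; last exact: differentiable_cst.
exact: (@differentiable_ssum _ id).
Qed.

Lemma derive_slack S x v : 'D_v (fun y => slack y S) x = ssum v S.
Proof.
rewrite (deriveB (f := fun y => ssum y S)) //.
- by rewrite (@derive_ssum _ id) // derive_id derive_cst subr0.
- exact/diff_derivable/(@differentiable_ssum _ id).
Qed.

(** Partial derivative of [mono] in the slack of S; for excess 0 the leading factor cancels the
    truncated exponent. *)
Definition dmono x tau S : R :=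
  (excess tau S)%:R * slack x S ^+ (excess tau S).-1 *
  \prod_(T | T != S) slack x T ^+ excess tau T.

Lemma differentiable_exp (V : normedModType R) (h : V -> R) n (p : V) :
  differentiable h p -> differentiable (fun q => h q ^+ n) p.
Proof.
move=> dh; elim: n => [|n IH].
  by under eq_fun do rewrite expr0; exact: differentiable_cst.
by under eq_fun do rewrite exprS; exact: differentiableM.
Qed.

Lemma derive_mono tau x v :
  'D_v (fun y => mono y tau) x = \sum_S ssum v S * dmono x tau S.
Proof.
have [_ ->] := @derive_prod _ _ (index_enum _) (fun S y => slack y S ^+ excess tau S)
  x v (index_enum_uniq _) (fun S => differentiable_exp _ (@differentiable_slack S x)).
apply: eq_bigr => S _; rewrite /dmono.
have -> : (fun y => slack y S ^+ excess tau S) = (fun y => slack y S) ^+ excess tau S.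
  by rewrite exprfctE.
rewrite deriveX; last exact: diff_derivable (@differentiable_slack S x).
by rewrite derive_slack scale_regular; ring.
Qed.

Lemma Dk_slack k U S : open U -> Dk k U (fun y => slack y S).
Proof.
move=> oU; apply: (@DkD _ _ _ _ _ _ (fun=> - f S)) => //; last exact: Dk_cst.
apply: Dk_sum => // i _; apply: Dk_entry => //.
exact/(@Dk_linear _ _ _ _ _ idfun)/linear_rV_continuous.
Qed.

Lemma Dk_mono k U tau : open U -> Dk k U (fun y => mono y tau).
Proof. by move=> oU; apply: Dk_prod => // S _; apply: DkX => //; exact: Dk_slack. Qed.

Lemma Dk_den k U : open U -> Dk k U den.
Proof. by move=> oU; apply: Dk_sum => // tau _; exact: Dk_mono. Qed.

Lemma open_den_neq0 : open [set x | den x != 0].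
Proof.
have -> : [set x | den x != 0] = den @^-1` [set a : R | a != 0] by [].
apply: open_comp; last exact: open_neq.
move=> x _; apply: differentiable_continuous.
exact: (Dk_diff (Dk_den 0 openT)).
Qed.

Lemma Dk_toric_map k : Dk k [set x | den x != 0] Phi.
Proof.
have oU := open_den_neq0.
apply: DkD => //.
  apply: Dk_sum => // tau _; apply: DkZl => //; apply: DkM => //; first exact: Dk_mono.
  by apply: DkV => //; exact: Dk_den.
apply: Dk_rV => // j.
by apply: Dk_ext (Dk_slack k finset.setT oU) => // x _; rewrite mxE.
Qed.

(* Obtained by differentiating den * (ssum of the map) = sum of mono * excess. *)
Lemma derive_toric_map_eq0 x v S : P x -> 'D_v Phi x = 0 ->
  \sum_tau 'D_v (fun y => mono y tau) x * (excess tau S)%:R =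
  (\sum_tau 'D_v (fun y => mono y tau) x) *
    ((\sum_tau mono x tau * (excess tau S)%:R) / den x) -
  den x * (#|S|%:R * ssum v finset.setT).
Proof.
move=> Px DPhi0.
have d0 : den x != 0 by rewrite gt_eqF ?den_gt0.
have dm tau y : differentiable (fun y => mono y tau) y.
  exact: (Dk_diff (Dk_mono 0 tau openT)).
have dP : differentiable Phi x by exact: (Dk_diff (Dk_toric_map 0)).
pose L y := ssum (Phi y) S - (std S + #|S|%:R * slack y finset.setT).
have dPS : differentiable (fun y => ssum (Phi y) S) x by exact: differentiable_ssum.
have dsT : differentiable (fun y => std S + #|S|%:R * slack y finset.setT) x.
  apply: differentiableD; first exact: differentiable_cst.
  by apply: differentiableM; [exact: differentiable_cst|exact: differentiable_slack].
have dL : differentiable L x by exact: differentiableB.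
have DL : 'D_v L x = - (#|S|%:R * ssum v finset.setT).
  rewrite (deriveB (f := fun y => ssum (Phi y) S)); [|exact: diff_derivable..].
  rewrite derive_ssum // DPhi0 (_ : ssum 0 S = 0); last first.
    by rewrite /ssum big1 // => i _; rewrite mxE.
  rewrite sub0r; congr (- _).
  rewrite (deriveD (f := cst (std S))); [|exact: derivable_cst|]; last first.
    by apply: diff_derivable; apply: differentiableM;
      [exact: differentiable_cst|exact: differentiable_slack].
  rewrite derive_cst add0r (deriveM (f := cst _)) ?derive_cst ?scaler0 ?addr0 //.
    by rewrite derive_slack.
  exact/diff_derivable/differentiable_slack.
have Lx : L x = (\sum_tau mono x tau * (excess tau S)%:R) / den x.
  by rewrite /L ssum_toric_map //; ring.
have NE : {near x, (fun y => \sum_tau mono y tau * (excess tau S)%:R) =1 den \* L}.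
  have : \forall y \near x, den y != 0.
    by apply: open_nbhs_nbhs; split=> //; exact: open_den_neq0.
  apply: filterS => y dy /=.
  by rewrite /L ssum_toric_map //; field.
have := near_eq_derive v NE.
have DN : 'D_v (fun y => \sum_tau mono y tau * (excess tau S)%:R) x =
    \sum_tau 'D_v (fun y => mono y tau) x * (excess tau S)%:R.
  rewrite derive_fsum => [|tau]; last first.
    by apply: differentiableM => //; exact: differentiable_cst.
  apply: eq_bigr => tau _.
  rewrite (deriveM (g := cst _)); [|exact: diff_derivable|exact: derivable_cst].
  by rewrite derive_cst scaler0 add0r scale_regular mulrC.
have Dden : 'D_v den x = \sum_tau 'D_v (fun y => mono y tau) x.
  by rewrite derive_fsum.
rewrite DN => ->.
rewrite deriveM; [|exact/diff_derivable/(Dk_diff (Dk_den 0 openT))|exact: diff_derivable].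
by rewrite DL Lx Dden !scale_regular mulrN addrC mulrC.
Qed.

Lemma dmono_active x tau S G : active x G -> G != S ->
  dmono x tau S * (excess tau G)%:R = 0.
Proof.
move=> /eqP aG GS; have [->|e0] := posnP (excess tau G); first by rewrite mulr0.
by rewrite /dmono (bigD1 G) //= aG expr0n gtn_eqF // !(mul0r, mulr0).
Qed.

Lemma dmono_ge0 x tau S : P x -> 0 <= dmono x tau S.
Proof.
move=> Px; rewrite mulr_ge0 ?mulr_ge0 ?exprn_ge0 ?slack_ge0 //.
by apply: prodr_ge0 => T _; rewrite exprn_ge0 ?slack_ge0.
Qed.

Lemma dmono_inactive x tau S : ~~ active x S ->
  dmono x tau S = (excess tau S)%:R / slack x S * mono x tau.
Proof.
move=> aS; rewrite /dmono /mono [in RHS](bigD1 S) //=.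
case: (excess tau S) => [|e]; first by rewrite !mul0r.
by rewrite /= exprS; field.
Qed.

(** The weighted mean of vertices stays in the hyperplane of the permutohedron, so the total
    coordinate sum sees only the last summand of the map. *)
Lemma derive_toric_map_T x v : P x -> 'D_v Phi x = 0 -> ssum v finset.setT = 0.
Proof.
move=> Px /(derive_toric_map_eq0 finset.setT Px).
have e0 tau : excess tau finset.setT = 0%N.
  by apply/eqP/excess_eq0P => i j _; rewrite finset.in_setT.
rewrite [X in X = _]big1 => [|tau _]; last by rewrite e0 mulr0.
rewrite [X in _ * (X / _)]big1 => [|tau _]; last by rewrite e0 mulr0.
rewrite mul0r mulr0 sub0r => /esym/eqP; rewrite oppr_eq0 !mulf_eq0 gt_eqF ?den_gt0 //=.
case/orP => [|/eqP//]; rewrite pnatr_eq0 cards_eq0 => /eqP ->.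
by rewrite ssum0.
Qed.

(** In the differentiated identity for G, only the derivatives in the slack of G survive. They enter
    with nonnegative coefficients, and the vertex from [excess_adjacent] makes one of them positive:
    height 1 leaves the slack of G with exponent 0. *)
Lemma derive_toric_map_active x v G : P x -> 'D_v Phi x = 0 -> active x G -> ssum v G = 0.
Proof.
move=> Px DPhi aG.
have vT := derive_toric_map_T Px DPhi.
have [->|G0] := eqVneq G finset.set0; first by rewrite ssum0.
have [->//|GT] := eqVneq G finset.setT.
have := derive_toric_map_eq0 G Px DPhi.
rewrite vT !mulr0 subr0 [X in _ * (X / _)]big1 ?mul0r ?mulr0; last first.
  move=> tau _; have [->|e0] := posnP (excess tau G); first by rewrite mulr0.
  by rewrite (mono_eq0 aG) ?mul0r.
rewrite (eq_bigr (fun tau => ssum v G * (dmono x tau G * (excess tau G)%:R))).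
  rewrite -mulr_sumr => /eqP; rewrite mulf_eq0 => /orP[/eqP//|].
  have [tau tG tS] := excess_adjacent (active_chain Px) aG G0 GT.
  rewrite gt_eqF // (bigD1 tau) //= ltr_pwDl //; last first.
    by rewrite sumr_ge0 // => t _; rewrite mulr_ge0 ?dmono_ge0.
  rewrite tG mulr1 /dmono tG expr0 !mul1r lt0r; apply/andP; split; last first.
    by apply: prodr_ge0 => T _; rewrite exprn_ge0 ?slack_ge0.
  apply/prodf_neq0 => S SG; rewrite expf_eq0 negb_and lt0n negbK.
  have [aS|naS] := boolP (active x S); first by rewrite tS.
  by rewrite naS orbT.
move=> tau _; rewrite derive_mono mulr_suml (bigD1 G) //= big1 ?addr0 ?mulrA //.
by move=> S SG; rewrite -mulrA dmono_active ?mulr0 // eq_sym.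
Qed.

(** Infinitesimal form of [toric_map_inj]: [a] is the logarithmic derivative of the slacks along v.
    Zero variance makes [h] constant on the face, and rigidity then annihilates the sum of the
    squares of [ssum v S] divided by the slacks, the Hessian of the potential. *)
Lemma derive_toric_map_inj x v : P x -> 'D_v Phi x = 0 -> v = 0.
Proof.
move=> Px DPhi.
have vA S : active x S -> ssum v S = 0 by exact: derive_toric_map_active.
pose a S := ssum v S / slack x S.
pose h tau := \sum_S a S * (excess tau S)%:R.
pose l tau := mono x tau / den x.
have d0 := den_gt0 Px.
have Dm tau : 'D_v (fun y => mono y tau) x = den x * (l tau * h tau).
  rewrite derive_mono /h /l !mulr_sumr; apply: eq_bigr => S _.
  have [aS|naS] := boolP (active x S); first by rewrite /a vA // !(mul0r, mulr0).
  rewrite dmono_inactive // /a; field.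
  by rewrite naS gt_eqF.
have l1 : \sum_tau l tau = 1 by rewrite -mulr_suml divff // gt_eqF.
pose hm := \sum_tau l tau * h tau.
have E S : \sum_tau l tau * h tau * (excess tau S)%:R = hm * \sum_tau l tau * (excess tau S)%:R.
  have := derive_toric_map_eq0 S Px DPhi.
  rewrite (derive_toric_map_T Px DPhi) !mulr0 subr0.
  under eq_bigr do rewrite Dm -mulrA.
  under [X in _ = X * _]eq_bigr do rewrite Dm.
  rewrite -!mulr_sumr -/hm -mulrA => /(mulfI (lt0r_neq0 d0)) ->.
  by rewrite mulr_suml; congr (_ * _); apply: eq_bigr => tau _; rewrite /l; ring.
have Eh : \sum_tau l tau * h tau * h tau = hm * hm.
  rewrite [in RHS]/hm -[X in _ * X]/(\sum_tau l tau * h tau).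
  transitivity (\sum_S a S * \sum_tau l tau * h tau * (excess tau S)%:R).
    rewrite /h; under [RHS]eq_bigr do rewrite mulr_sumr.
    rewrite exchange_big; apply: eq_bigr => tau _; rewrite mulr_sumr.
    by apply: eq_bigr => S _; ring.
  under eq_bigr do rewrite E mulrCA mulr_sumr.
  rewrite -mulr_sumr exchange_big; congr (_ * _); apply: eq_bigr => tau _.
  by rewrite /h mulr_sumr; apply: eq_bigr => S _; ring.
(* The derivative in a direction tangent to the face is a covariance; here the variance of h. *)
have V0 : \sum_tau l tau * (h tau - hm) ^+ 2 = 0.
  rewrite (eq_bigr (fun tau => l tau * h tau * h tau - 2 * hm * (l tau * h tau) + hm * hm * l tau)).
    by rewrite big_split sumrB -!mulr_sumr l1 Eh -/hm /=; ring.
  by move=> tau _; ring.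
have l_ge0 tau : 0 <= l tau by rewrite divr_ge0 ?mono_ge0 // ltW.
have hC tau : compatible (active x) tau -> h tau = hm.
  move=> tauC; have Hz := psumr_eq0P (fun t _ => mulr_ge0 (l_ge0 t) (sqr_ge0 (h t - hm))) V0.
  have /eqP := Hz tau isT; rewrite mulf_eq0 gt_eqF ?divr_gt0 ?mono_gt0 //=.
  by rewrite sqrf_eq0 subr_eq0 => /eqP.
have Z := chain_rigidity (active_chain Px) (active0 x) (activeT Px) hC vA.
apply: ssum_eq0 => S; have [/vA//|naS] := boolP (active x S).
have aE t : a t * ssum v t = ssum v t ^+ 2 / slack x t by rewrite /a; ring.
have age t : 0 <= a t * ssum v t by rewrite aE divr_ge0 ?sqr_ge0 ?slack_ge0.
have /eqP := psumr_eq0P (fun t _ => age t) Z (i := S) isT.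
by rewrite aE mulf_eq0 invr_eq0 -/(active x S) (negPf naS) orbF sqrf_eq0 => /eqP.
Qed.
End Polytope_map.

(** * Surjectivity and smoothness of the inverse *)

Section Polytope_diffeomorphism.
Context {R : realType} {c : nat}.
Implicit Types (x y z v : 'rV[R]_c) (S T G : {set 'I_c}) (tau : 'S_c).
Variable f : {set 'I_c} -> R.
Hypothesis f0 : f finset.set0 = 0.
Hypothesis f_smod : strict_supermodular f.
Local Notation P := (gen_permutohedron f).
Local Notation Phi := (toric_map f).
Local Notation Q := (gen_permutohedron (@std R c)).

Lemma continuous_slack S : continuous (fun x : 'rV[R]_c => slack f x S).
Proof. by move=> x; exact/differentiable_continuous/differentiable_slack. Qed.

(** For boundedness, a coordinate is bounded below by the inequality of its singleton and above by
    that of the complement. *)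
Lemma compact_gperm : compact P.
Proof.
apply: bounded_closed_compact.
  pose M := \sum_S `|f S|.
  have fM S : `|f S| <= M by rewrite /M (bigD1 S) //= lerDl sumr_ge0.
  exists (2 * M); split; first exact: num_real.
  move=> N MN x [Px PT] /=; apply: (le_trans _ (ltW MN)).
  have M0 : 0 <= M by rewrite sumr_ge0.
  apply: rV_norm_le => [|i]; first by rewrite mulr_ge0.
  have := Px [set i]%SET; rewrite {1}/ssum big_set1 => H1.
  have := Px (~: [set i])%SET; have := ssumUI x [set i]%SET (~: [set i])%SET.
  rewrite finset.setUCr finset.setICr ssum0 PT addr0 {1}/ssum big_set1 => H3 H2.
  have := fM finset.setT; have := fM (~: [set i])%SET; have := fM [set i]%SET.
  by rewrite !ler_norml; lra.
have -> : P = \bigcap_(S in [set: {set 'I_c}]) ((fun x => slack f x S) @^-1` [set a : R | 0 <= a])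
    `&` (fun x => slack f x finset.setT) @^-1` [set a : R | a = 0].
  apply/seteqP; split=> x /=.
    move=> Px; split=> [S _|]; [exact: slack_ge0|exact: slackT].
  by move=> [H1 /subr0_eq H2]; split=> // S; have := H1 S I; rewrite /= subr_ge0.
apply: closedI.
  apply: closed_bigI => S _; apply: closed_comp; last exact: closed_ge.
  by move=> x _; exact: continuous_slack.
apply: closed_comp; last exact: closed_eq.
by move=> x _; exact: continuous_slack.
Qed.

Lemma toric_map_differentiable x : P x -> differentiable Phi x.
Proof.
move=> Px; apply: (Dk_diff (Dk_toric_map f 0)).
by rewrite /= gt_eqF // den_gt0.
Qed.

Lemma compact_image_closed (K : set 'rV[R]_c) : K `<=` P -> compact K -> closed (Phi @` K).
Proof.
move=> KP cK; apply: compact_closed; first exact: norm_hausdorff.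
apply: continuous_compact cK; apply: continuous_in_subspaceT => x /set_mem/KP Px.
exact/differentiable_continuous/toric_map_differentiable.
Qed.

Lemma toric_local_inverse x (O : set 'rV[R]_c) : P x -> open O -> O x ->
  exists (U' V' : set 'rV[R]_c) (g : 'rV[R]_c -> 'rV[R]_c),
    [/\ open U', U' x & U' `<=` O `&` [set x | den f x != 0]] /\
    [/\ open V',
        forall x, U' x -> V' (Phi x) /\ g (Phi x) = x,
        forall y, V' y -> U' (g y) /\ Phi (g y) = y &
        forall k, Dk k V' g].
Proof.
move=> Px oO Ox; apply: inverse_function.
- by apply: openI => //; exact: open_den_neq0.
- by split=> //=; rewrite gt_eqF // den_gt0.
- by move=> k; apply: Dk_sub (Dk_toric_map f k) => y [].
- by move=> v; exact: derive_toric_map_inj.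
Qed.

(** The inverse function theorem yields preimages near x in the whole space; they keep positive
    proper slacks, and the last summand of the map forces them into the hyperplane of P. *)
Lemma image_open_interior x : P x ->
  (forall S, active f x S -> S = finset.set0 \/ S = finset.setT) ->
  exists V' : set 'rV[R]_c, [/\ open V', V' (Phi x) &
    forall y, V' y -> ssum y finset.setT = @std R c finset.setT -> (Phi @` P) y].
Proof.
move=> Px aS.
pose O := [set y : 'rV[R]_c | forall S, S != finset.set0 /\ S != finset.setT -> 0 < slack f y S].
have oO : open O.
  rewrite openE => y Oy.
  apply: (@filter_forall _ {set 'I_c}
    (fun S z => S != finset.set0 /\ S != finset.setT -> 0 < slack f z S) (nbhs y)) => S.
  have [H|nH] := pselect (S != finset.set0 /\ S != finset.setT); last first.
    by near=> z => /nH.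
  have : nbhs (slack f y S) [set a : R | 0 < a].
    by apply: open_nbhs_nbhs; split; [exact: open_gt|exact: Oy].
  move=> Hs; have {}Hs := @continuous_slack S y _ Hs.
  by near=> z => _; near: z; exact: Hs.
have Ox : O x.
  move=> S /= [S0 ST]; rewrite lt0r slack_ge0 // andbT.
  by apply/negP => /aS[E|E]; [rewrite E eqxx in S0|rewrite E eqxx in ST].
have [U' [V' [g [[oU U'x UO] [oV gF Fg _]]]]] := toric_local_inverse Px oO Ox.
exists V'; split=> //; first by have [] := gF _ U'x.
move=> y Vy yT; have [Ugy Fgy] := Fg y Vy.
have [Ogy /= dgy] := UO _ Ugy.
exists (g y) => //.
have sT : slack f (g y) finset.setT = 0.
  have e0 tau : excess tau (finset.setT : {set 'I_c}) = 0%N.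
    by apply/eqP/excess_eq0P => i j _; rewrite finset.in_setT.
  have := ssum_toric_map finset.setT dgy; rewrite Fgy yT [X in X / _]big1; last first.
    by move=> tau _; rewrite e0 mulr0.
  rewrite mul0r addr0 -[LHS]addr0 => /addrI/esym/eqP; rewrite mulf_eq0.
  case/orP => [|/eqP//]; rewrite pnatr_eq0 cards_eq0 => /eqP E.
  by rewrite /slack E ssum0 f0 subrr.
split=> [S|]; last by apply: subr0_eq.
have [->|S0] := eqVneq S finset.set0; first by rewrite f0 ssum0.
have [->|ST] := eqVneq S finset.setT; first by rewrite (subr0_eq sT).
by rewrite -subr_ge0 ltW //; apply: Ogy.
Unshelve. all: by end_near. Qed.

Hypothesis interior : exists2 a, P a &
  forall S, active f a S -> S = finset.set0 \/ S = finset.setT.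

(** Follow the segment from the image b of an interior point to y up to the last parameter s at
    which it meets the closed image. If s < 1, that point is interior, and the image is open around
    it. *)
Lemma toric_surjective y : Q y -> (Phi @` P) y.
Proof.
move=> [Qy QT]; have [a Pa aS] := interior.
have [Qb QbT] := toric_map_gperm f0 f_smod Pa; set b := Phi a in Qb QbT.
pose ga t : 'rV[R]_c := (1 - t) *: b + t *: y.
have gaT t : ssum (ga t) finset.setT = @std R c finset.setT.
  by rewrite ssumD !ssumZ QbT QT; rewrite -mulrDl subrK mul1r.
have cga : continuous ga.
  move=> t; apply: differentiable_continuous; apply: differentiableD.
    by apply: differentiableZl; apply: differentiableB.
  exact: differentiableZl.
pose Z := [set t : R | 0 <= t <= 1] `&` ga @^-1` (Phi @` P).
have cPhiP : closed (Phi @` P) by apply: compact_image_closed => //; exact: compact_gperm.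
have Z0 : Z 0.
  by split; [rewrite /= lexx ler01|exists a; rewrite // /ga subr0 scale1r scale0r addr0].
have cZ : closed Z.
  apply: closedI; last by apply: closed_comp cPhiP => t _; exact: cga.
  have -> : [set t : R | 0 <= t <= 1] = [set t | 0 <= t] `&` [set t | t <= 1].
    by apply/seteqP; split=> t /= => [/andP[]|[]] H1 H2; [split|apply/andP; split].
  by apply: closedI; [exact: closed_ge|exact: closed_le].
have ubZ : has_ubound Z by exists 1 => t [/= /andP[]].
have Zs : Z (sup Z).
  by apply: cZ; apply: closure_sup => //; exists 0.
set s := sup Z in Zs; have [/= /andP[s0 s1] [x Px Exs]] := Zs.
have [s_eq|sn1] := eqVneq s 1.
  by exists x => //; rewrite Exs s_eq /ga subrr scale0r scale1r add0r.
have {sn1}s1 : s < 1 by rewrite lt_neqAle sn1.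
(* For s < 1 the point [ga s] has a positive share of b, so it is tight only where b is;
   [toric_map_active] carries this back to x and a. *)
have xS S : active f x S -> S = finset.set0 \/ S = finset.setT.
  rewrite -(toric_map_active f0 f_smod S Px) Exs ssumD !ssumZ => /eqP E.
  apply: aS; rewrite -(toric_map_active f0 f_smod S Pa) -/b eq_le Qb andbT leNgt; apply/negP => H.
  have H1 : 0 < (1 - s) * (ssum b S - std S) by rewrite mulr_gt0 ?subr_gt0.
  have H2 : 0 <= s * (ssum y S - std S) by rewrite mulr_ge0 // subr_ge0.
  have : 0 < (1 - s) * (ssum b S - std S) + s * (ssum y S - std S) by rewrite ltr_wpDr.
  rewrite (_ : _ + _ = (1 - s) * ssum b S + s * ssum y S - std S); last by ring.
  by rewrite E subrr ltxx.
have [V' [oV Vx HV]] := image_open_interior Px xS.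
have : nbhs s (ga @^-1` V').
  by apply: cga; apply: open_nbhs_nbhs; split=> //; rewrite -Exs.
move=> /nbhs_ballP[e /= e0 He].
pose t := Num.min 1 (s + e / 2).
have ts : s < t by rewrite lt_min s1 ltrDl divr_gt0.
have Zt : Z t.
  split; first by rewrite /= ge_min lexx /= (le_trans s0) // ltW.
  apply: HV => //; apply: He; rewrite -ball_normE /= distrC ger0_norm ?subr_ge0 ?ltW //.
  by rewrite ltrBlDl gt_min ltrD2l ltr_pdivrMr // ltr_pMr // ltr1n orbT.
by have := ub_le_sup ubZ Zt; rewrite leNgt ts.
Qed.

Theorem toric_diffeomorphism : [/\ set_bij P Q Phi, Dsmooth_on P Phi &
  exists g, (forall x, P x -> g (Phi x) = x) /\ Dsmooth_on Q g].
Proof.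
have bij : set_bij P Q Phi.
  split=> [x Px|x y /set_mem Px /set_mem Py|y]; first exact: toric_map_gperm.
    exact: toric_map_inj.
  exact: toric_surjective.
split=> //.
  move=> x Px; exists [set x | den f x != 0], Phi; split=> //.
  - exact: open_den_neq0.
  - by rewrite /= gt_eqF // den_gt0.
  - by move=> k; exact: Dk_toric_map.
pose Psi y := xget 0 [set x | P x /\ Phi x = y].
have PsiP x : P x -> Psi (Phi x) = x.
  move=> Px; have [Px' Ex'] : P (Psi (Phi x)) /\ Phi (Psi (Phi x)) = Phi x.
    by apply: (@xgetPex _ 0 [set x' | P x' /\ Phi x' = Phi x]); exists x.
  exact: toric_map_inj Ex'.
exists Psi; split=> // y /toric_surjective[x Px <-].
have [U' [V' [g [[oU U'x _] [oV gF Fg Sg]]]]] := toric_local_inverse Px openT I.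
(* The local inverse agrees with [Psi] only at images of points of U'. The image of the rest of P is
   closed and, by injectivity, misses [Phi x], so it can be removed from the neighbourhood. *)
have cK : closed (Phi @` (P `&` ~` U')).
  apply: compact_image_closed; first by move=> z [].
  by apply: compact_closedI; [exact: compact_gperm|exact: open_closedC].
exists (V' `&` ~` (Phi @` (P `&` ~` U'))), g; split.
- by apply: openI => //; exact: closed_openC.
- split; first by have [] := gF _ U'x.
  by move=> [z [Pz nUz] /toric_map_inj E]; apply: nUz; rewrite E.
- by move=> k; apply: Dk_sub (Sg k) => z [].
- move=> z /toric_surjective[z' Pz' <-] [_ nK].
  rewrite PsiP //; have [Uz'|nUz'] := pselect (U' z'); first by have [_ ->] := gF _ Uz'.
  by exfalso; apply: nK; exists z'.
Qed.

(** A point satisfying the inequalities is a value of the toric map, which is by construction a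
    convex combination of the vertices. *)
Lemma gperm_std_permutohedron : Q = permutohedron R c.
Proof.
apply/seteqP; split=> [y /toric_surjective[x Px <-]|y [w [w0 w1 ->]]].
  exact: toric_map_weights.
have sE S : ssum (\sum_tau w tau *: perm_point R tau) S =
    std S + \sum_tau w tau * (excess tau S)%:R.
  rewrite ssum_sum -[in RHS](mulr1 (std S)) -[X in std S * X]w1 mulr_sumr -big_split /=.
  apply: eq_bigr => tau _; rewrite ssumZ ssum_perm_point natrD /std; ring.
split=> [S|]; rewrite sE; first by rewrite lerDl sumr_ge0 // => tau _; rewrite mulr_ge0 ?w0.
rewrite big1 ?addr0 // => tau _.
suff -> : excess tau (finset.setT : {set 'I_c}) = 0%N by rewrite mulr0.
by apply/eqP/excess_eq0P => i j _; rewrite finset.in_setT.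
Qed.
End Polytope_diffeomorphism.

(** * Cycles and fixed points *)

Section Cycle_index.
Context {n : nat} (sigma : 'S_n).

Definition minimal (i : 'I_n) := [forall j in porbit sigma i, (i <= j)%N].

Lemma minimal_exists i : exists2 j, j \in porbit sigma i & minimal j.
Proof.
have [j jP jmin] := arg_minnP (P := fun j => j \in porbit sigma i) val (porbit_id sigma i).
exists j => //; apply/forall_inP => k; rewrite -eq_porbit_mem => /eqP E.
by apply: jmin; move: jP; rewrite -!eq_porbit_mem E.
Qed.

Lemma minimal_inj i j : minimal i -> minimal j -> j \in porbit sigma i -> i = j.
Proof.
move=> /forall_inP mi /forall_inP mj ji; apply/val_inj/anti_leq.
by rewrite mi // mj // porbit_sym.
Qed.

Lemma card_minimal : #|[pred i | minimal i]| = #|porbits sigma|.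
Proof.
have -> : porbits sigma = [set porbit sigma i | i in [pred i | minimal i]]%SET.
  apply/setP => C; apply/imsetP/imsetP => [[i _ ->]|[i _ ->]]; last by exists i.
  have [j ji mj] := minimal_exists i; exists j => //.
  by apply/eqP; rewrite eq_porbit_mem porbit_sym.
rewrite card_in_imset // => i j mi mj /eqP; rewrite eq_porbit_mem porbit_sym.
by move=> /minimal_inj; exact.
Qed.

Lemma card_cycles (p : nat) (len : p.-tuple nat) :
  perm_eq len [seq #|C| | C : {set 'I_n} <- enum (porbits sigma)] ->
  (n - \sum_(i < p) (tnth len i - 1))%N = #|[pred i | minimal i]|.
Proof.
move=> len_cycles; rewrite card_minimal.
rewrite -(big_tuple _ _ len xpredT (fun l => l - 1)%N) (perm_big _ len_cycles) /= big_map.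
rewrite big_enum /=.
have nE : n = (\sum_(C in porbits sigma) (#|C| - 1) + #|porbits sigma|)%N.
  rewrite -[LHS]card_ord -sum1_card -sum1_card -big_split /=.
  rewrite (eq_bigr (fun C : {set 'I_n} => \sum_(i in C) 1)%N); last first.
    move=> C /imsetP[i _ ->]; rewrite sum1_card subnK //.
    by apply/card_gt0P; exists i; exact: porbit_id.
  rewrite (exchange_big_dep xpredT) //=; apply: eq_bigr => i _.
  rewrite (big_pred1 (porbit sigma i)) // => C.
  apply/andP/eqP => [[/imsetP[j _ ->]]|->].
    by rewrite -eq_porbit_mem eq_sym => /eqP.
  by rewrite porbit_id imset_f.
by rewrite [X in (X - _)%N]nE addKn.
Qed.

(** Cycles are numbered by increasing smallest element, the numbering that the successive reductions
    produce. *)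
Lemma cycle_index c : c = #|[pred i | minimal i]| ->
  exists (kap : 'I_n -> 'I_c) (rep : 'I_c -> 'I_n),
  [/\ forall k, kap (rep k) = k,
      forall k, minimal (rep k),
      forall i j, (kap i = kap j) <-> (j \in porbit sigma i) &
      forall i, minimal i -> kap i = #|[pred j | minimal j & (j < i)%N]| :> nat].
Proof.
move=> cE; pose r (i : 'I_n) := #|[pred j | minimal j & (j < i)%N]|.
have r_lt (i j : 'I_n) : minimal i -> (i < j)%N -> (r i < r j)%N.
  move=> mi ij; apply: proper_card; apply/properP; split.
    by apply/fintype.subsetP => k; rewrite !inE => /andP[-> /ltn_trans]; exact.
  by exists i; rewrite !inE ?mi ?ltnn.
have r_inj i j : minimal i -> minimal j -> r i = r j -> i = j.
  move=> mi mj E; apply/val_inj.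
  by case: (ltngtP i j) => // H; [have := r_lt _ _ mi H|have := r_lt _ _ mj H]; rewrite E ltnn.
have rc i : minimal i -> (r i < c)%N.
  move=> mi; rewrite cE; apply: proper_card; apply/properP; split.
    by apply/fintype.subsetP => k; rewrite !inE => /andP[].
  by exists i; rewrite !inE ?mi ?ltnn.
have [m mi mmin] := fin_all_exists2 minimal_exists.
pose kap i := Ordinal (rc (m i) (mmin i)).
have mE i : minimal i -> m i = i.
  by move=> Mi; apply: minimal_inj => //; rewrite porbit_sym.
have kapE i : minimal i -> kap i = r i :> nat by move=> Mi; rewrite /= mE.
have kapS k : exists i, minimal i && (kap i == k).
  have : kap @: [pred i | minimal i] = finset.setT.
    apply/eqP; rewrite eqEcard finset.subsetT cardsT card_ord /=.
    rewrite card_in_imset ?[X in (X <= _)%N]cE //.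
    by move=> i j Mi Mj /(congr1 (@nat_of_ord c)); rewrite !kapE //; exact: r_inj.
  move/setP/(_ k); rewrite finset.in_setT => /imsetP[i Mi ->].
  by exists i; apply/andP.
have [rep repP] := fin_all_exists kapS.
have kap_eq i j : kap i = kap j <-> j \in porbit sigma i.
  split=> [/(congr1 val) /= /r_inj mij|ji].
    have {}mij := mij (mmin i) (mmin j).
    have := mi j; rewrite -mij porbit_sym -eq_porbit_mem => /eqP E.
    by have := mi i; rewrite -!eq_porbit_mem E.
  apply/val_inj => /=; congr r; apply: minimal_inj => //.
  have := mi i; have := mi j; move: ji; rewrite -!eq_porbit_mem.
  by move=> /eqP -> /eqP -> /eqP ->.
exists kap, rep; split=> // [k|k]; by have /andP[/[swap] /eqP] := repP k.
Qed.
End Cycle_index.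

(** * The polytope of fiber sums *)

Section Quotient.
Context {R : realType} {n c : nat}.
Variables (kap : 'I_n -> 'I_c) (rep : 'I_c -> 'I_n).
Hypothesis kapK : forall k, kap (rep k) = k.
Implicit Types (S T : {set 'I_c}) (A : {set 'I_n}) (x : 'rV[R]_n) (z : 'rV[R]_c).

Definition weight (k : 'I_c) : nat := #|kap @^-1: [set k]%SET|.
Definition quotient_tri S : R := (tri #|kap @^-1: S|)%:R.
Definition fiber_constant x := forall i j, kap i = kap j -> x 0 i = x 0 j.
Definition saturated A := forall i j, kap i = kap j -> i \in A -> j \in A.

(* On fiber-constant points, the new coordinate of a fiber is the sum of the old ones over it. *)
Definition to_quotient x : 'rV[R]_c :=
  x *m \matrix_(i, k) (if i == rep k then (weight k)%:R else 0).
Definition from_quotient z : 'rV[R]_n :=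
  z *m \matrix_(k, i) (if k == kap i then (weight k)%:R^-1 else 0).

Lemma to_quotientE x k : to_quotient x 0 k = (weight k)%:R * x 0 (rep k).
Proof.
rewrite mxE (bigD1 (rep k)) //= big1 ?addr0 => [|i ik]; rewrite mxE; last first.
  by rewrite (negPf ik) mulr0.
by rewrite eqxx mulrC.
Qed.

Lemma from_quotientE z i : from_quotient z 0 i = z 0 (kap i) / (weight (kap i))%:R.
Proof.
rewrite mxE (bigD1 (kap i)) //= big1 ?addr0 => [|k ik]; rewrite mxE ?eqxx //.
by rewrite (negPf ik) mulr0.
Qed.

Lemma weight_gt0 k : (0 < weight k)%N.
Proof. by apply/card_gt0P; exists (rep k); rewrite inE inE kapK. Qed.

Lemma from_quotient_constant z : fiber_constant (from_quotient z).
Proof. by move=> i j ij; rewrite !from_quotientE ij. Qed.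

Lemma to_quotientK x : fiber_constant x -> from_quotient (to_quotient x) = x.
Proof.
move=> cx; apply/matrixP => i j; rewrite (ord1 i) from_quotientE to_quotientE.
rewrite mulrC mulKf ?pnatr_eq0 -?lt0n ?weight_gt0 //.
by apply: cx; rewrite kapK.
Qed.

Lemma from_quotientK z : to_quotient (from_quotient z) = z.
Proof.
apply/matrixP => i j; rewrite (ord1 i) to_quotientE from_quotientE kapK.
by rewrite mulrC divfK // pnatr_eq0 -lt0n weight_gt0.
Qed.

Lemma ssum_preim x (a : 'I_c -> R) S : (forall i, x 0 i = a (kap i)) ->
  ssum x (kap @^-1: S) = \sum_(k in S) (weight k)%:R * a k.
Proof.
move=> xa; rewrite /ssum (partition_big kap (mem S)) => [|i]; last by rewrite inE.
apply: eq_bigr => k kS; rewrite (eq_bigr (fun=> a k)) => [|i /andP[_ /eqP <-]//].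
rewrite sumr_const mulr_natl; congr (_ *+ _).
apply: eq_card => i; rewrite unfold_in /= !inE.
by apply: andb_idl => /eqP ->.
Qed.

Lemma ssum_to_quotient x S : fiber_constant x ->
  ssum (to_quotient x) S = ssum x (kap @^-1: S).
Proof.
move=> cx; rewrite (ssum_preim (a := fun k => x 0 (rep k))) => [|i]; last first.
  by apply: cx; rewrite kapK.
by apply: eq_bigr => k _; rewrite to_quotientE.
Qed.

Lemma card_preim_gt0 S : S != finset.set0 -> (0 < #|kap @^-1: S|)%N.
Proof. by case/set0Pn => k kS; apply/card_gt0P; exists (rep k); rewrite inE kapK. Qed.

Lemma quotient_tri0 : quotient_tri finset.set0 = 0.
Proof. by rewrite /quotient_tri finset.preimset0 cards0. Qed.

(** As [kap] is onto, the two differences have nonempty preimages and strict convexity of [tri]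
    applies. *)
Lemma quotient_tri_smod : strict_supermodular quotient_tri.
Proof.
move=> S T ST TS; rewrite /quotient_tri -!natrD ltr_nat.
have D (X Y : {set 'I_c}) : ~~ (X \subset Y) -> (0 < #|kap @^-1: (X :\: Y)|)%N.
  by rewrite -finset.setD_eq0; exact: card_preim_gt0.
have E (X Y : {set 'I_c}) : #|kap @^-1: X| = (#|kap @^-1: (X :&: Y)| + #|kap @^-1: (X :\: Y)|)%N.
  by rewrite -(cardsID (kap @^-1: Y)) finset.preimsetI finset.preimsetD.
rewrite (E (S :|: T) S) finset.setUK finset.setDUl finset.setDv finset.set0U.
rewrite (E S T) (E T S) [T :&: S]finset.setIC.
have := tri_strict_convex #|kap @^-1: (S :&: T)| (D _ _ ST) (D _ _ TS).
by rewrite addnC [X in (_ < X)%N]addnC.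
Qed.

(** The barycentre of the permutohedron, with all coordinates (n + 1) / 2: the inequality for a set
    of size k compares k (n + 1) / 2 with k (k + 1) / 2. *)
Lemma quotient_tri_interior : exists2 a, gen_permutohedron quotient_tri a &
  forall S, active quotient_tri a S -> S = finset.set0 \/ S = finset.setT.
Proof.
pose a : 'rV[R]_c := to_quotient (const_mx (n.+1%:R / 2)).
have aE S : ssum a S = #|kap @^-1: S|%:R * n.+1%:R / 2.
  rewrite ssum_to_quotient; first by rewrite ssum_const mulrA.
  by move=> i j _; rewrite !mxE.
have qE S : quotient_tri S = #|kap @^-1: S|%:R * #|kap @^-1: S|.+1%:R / 2.
  apply: (@mulIf _ 2) => //; rewrite divfK // /quotient_tri -!natrM.
  by rewrite tri_double.
have le_n A : (#|A| <= n)%N by rewrite -[X in (_ <= X)%N]card_ord max_card.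
exists a => [|S].
  split=> [S|]; rewrite aE qE.
    by rewrite ler_pM2r ?invr_gt0 // ler_wpM2l // ler_nat ltnS.
  by rewrite finset.preimsetT cardsT card_ord.
rewrite /active /slack subr_eq0 aE qE (inj_eq (mulIf _)) ?invr_eq0 ?pnatr_eq0 // -!natrM eqr_nat.
have [->|S0] := eqVneq S finset.set0; first by left.
rewrite eqn_pmul2l ?card_preim_gt0 // eqSS => /eqP nS; right.
apply/setP => k; rewrite finset.in_setT -[k]kapK.
have : kap @^-1: S = finset.setT.
  by apply/eqP; rewrite eqEcard finset.subsetT cardsT card_ord -nS leqnn.
by move=> /setP/(_ (rep k)); rewrite inE finset.in_setT.
Qed.

Lemma saturated_preim A : saturated A -> kap @^-1: (kap @: A) = A.
Proof.
move=> sA; apply/setP => i; rewrite inE; apply/imsetP/idP => [[j jA ij]|iA]; last by exists i.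
exact: sA (esym ij) jA.
Qed.

(** If A split a fiber, with i inside and j outside, comparing with A minus i and with A plus j
    would give x_i at most |A| and x_j at least |A| + 1. *)
Lemma tight_saturated x A : fiber_constant x ->
  (forall A', ssum x A - std A <= ssum x A' - std A') -> saturated A.
Proof.
move=> cx Amin i j ij iA; apply/negPn/negP => jA.
have xij := cx _ _ ij.
have := Amin (A :\ i)%SET; have := Amin (j |: A)%SET.
have E1 : ssum x A = x 0 i + ssum x (A :\ i)%SET by rewrite /ssum (big_setD1 i).
have E2 : ssum x (j |: A)%SET = x 0 j + ssum x A by rewrite /ssum big_setU1.
have c1 : #|A| = #|(A :\ i)%SET|.+1 by rewrite (cardsD1 i A) iA.
have T : std (j |: A)%SET + std (A :\ i)%SET = 2 * std A + 1 :> R.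
  rewrite /std cardsU1 jA c1 add1n !triS -!natrD -natrM -(natrD _ _ 1%N); congr (_%:R); lia.
rewrite E2 E1 xij; lra.
Qed.
End Quotient.

Lemma permutohedronE (R : realType) n : permutohedron R n = gen_permutohedron (@std R n).
Proof.
have idK : forall i : 'I_n, @idfun 'I_n (@idfun 'I_n i) = i by [].
by rewrite -(gperm_std_permutohedron (quotient_tri0 (R := R) idfun)
  (quotient_tri_smod (R := R) idK) (quotient_tri_interior (R := R) idK)).
Qed.

Section Quotient_diffeomorphism.
Context {R : realType} {n c : nat}.
Variables (kap : 'I_n -> 'I_c) (rep : 'I_c -> 'I_n).
Hypothesis kapK : forall k, kap (rep k) = k.
Implicit Types (S T : {set 'I_c}) (A : {set 'I_n}) (x : 'rV[R]_n) (z : 'rV[R]_c).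

Let F : set 'rV[R]_n := permutohedron R n `&` [set x | fiber_constant kap x].
Let P := gen_permutohedron (@quotient_tri R n c kap).

Lemma to_quotient_gperm x : F x -> P (to_quotient kap rep x).
Proof.
rewrite /F permutohedronE => -[[Hx HT] cx].
split=> [S|]; rewrite (ssum_to_quotient kapK) //; first exact: Hx.
by rewrite finset.preimsetT HT /quotient_tri finset.preimsetT.
Qed.

(** P provides only the inequalities of saturated sets; they suffice, because the least slack is
    attained at a saturated set. *)
Lemma from_quotient_gperm z : P z -> F (from_quotient kap z).
Proof.
move=> [Hz HT]; have cx := from_quotient_constant (kap := kap) z; split=> //.
have E S : ssum (from_quotient kap z) (kap @^-1: S) = ssum z S.
  by rewrite -(ssum_to_quotient kapK) // (from_quotientK kapK).
rewrite permutohedronE; split=> [A|]; last first.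
  by have := E finset.setT; rewrite HT /quotient_tri finset.preimsetT.
set x := from_quotient kap z in cx E *.
have [A0 _ A0min] := @Order.TotalTheory.arg_minP _ R {set 'I_n} A xpredT
  (fun A => ssum x A - std A) isT.
have sA0 : saturated kap A0 by apply: (tight_saturated cx) => A'; exact: A0min.
rewrite -subr_ge0 (le_trans _ (A0min A isT)) // subr_ge0.
rewrite -(saturated_preim sA0) E; exact: Hz.
Qed.

Theorem quotient_diffeomorphism : exists psi : 'rV[R]_n -> 'rV[R]_c,
  diffeomorphism_on F (permutohedron R c) psi /\
  forall x A, F x -> saturated kap A ->
    (ssum (psi x) (kap @: A) == std (kap @: A)) = (ssum x A == std A).
Proof.
have f0 := quotient_tri0 (R := R) kap; have fs := quotient_tri_smod (R := R) kapK.
have fi := quotient_tri_interior (R := R) kapK.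
have [[PhiP toric_map_inj toric_map_surj] sPhi [g [gK sg]]] := toric_diffeomorphism f0 fs fi.
set f := quotient_tri kap in f0 fs fi PhiP toric_map_inj toric_map_surj sPhi gK sg.
exists (toric_map f \o to_quotient kap rep); split; last first.
  move=> x A Fx sA; rewrite /= (toric_map_active f0 fs _ (to_quotient_gperm Fx)).
  rewrite /active /slack subr_eq0 (ssum_to_quotient kapK); last by case: Fx.
  by rewrite /f /quotient_tri saturated_preim.
have fromK x : F x -> from_quotient kap (to_quotient kap rep x) = x.
  by case=> _; exact: (to_quotientK kapK).
rewrite permutohedronE; split.
- split=> [x Fx|x y /set_mem Fx /set_mem Fy E|y Qy]; first exact/PhiP/to_quotient_gperm.
    have := toric_map_inj _ _ (mem_set (to_quotient_gperm Fx)) (mem_set (to_quotient_gperm Fy)) E.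
    by move=> /(congr1 (from_quotient kap)); rewrite !fromK.
  have [z Pz <-] := toric_map_surj y Qy; exists (from_quotient kap z).
    exact: from_quotient_gperm.
  by rewrite /= (from_quotientK kapK).
- apply: Dsmooth_smooth; apply: Dsmooth_comp to_quotient_gperm sPhi _.
  exact: (@Dsmooth_linear _ _ _ _ (mulmxr _)).
- exists (from_quotient kap \o g); split.
    by move=> x Fx /=; rewrite gK ?fromK //; exact: to_quotient_gperm.
  apply: Dsmooth_smooth; apply: (Dsmooth_comp (B := setT)) => //.
  exact: (@Dsmooth_linear _ _ _ _ (mulmxr _)).
Qed.
End Quotient_diffeomorphism.

(** * Faces and reductions *)

Section Ordered_partitions.

Lemma sum_tri m : (\sum_(1 <= k < m.+1) k = tri m)%N.
Proof.
elim: m => [|m IH]; first by rewrite big_geq.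
by rewrite big_nat_recr //= IH triS.
Qed.

Definition initial_union (r : nat) (p : seq {fset nat}) (j : nat) : {set 'I_r} :=
  [set i : 'I_r | val i \in (\bigcup_(P <- take j p) P)%fset]%SET.

Lemma mem_bigfcup (p : seq {fset nat}) x :
  reflect (exists2 P, P \in p & x \in P) (x \in (\bigcup_(P <- p) P)%fset).
Proof.
elim: p => [|P p IH]; first by rewrite big_nil; constructor => -[].
rewrite big_cons inE; apply: (iffP orP) => [[xP|/IH[P' P'p xP']]|[P' + xP']].
- by exists P => //; exact: mem_head.
- by exists P' => //; rewrite in_cons P'p orbT.
- by rewrite in_cons => /orP[/eqP <-|P'p]; [left|right; apply/IH; exists P'].
Qed.

Lemma partition_lt r p P x : ordered_partition r p -> P \in p -> x \in P -> (x < r)%N.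
Proof.
move=> /and3P[_ _ /eqP U] Pp xP.
have : x \in (\bigcup_(P <- p) P)%fset by apply/mem_bigfcup; exists P.
by rewrite U !inE mem_iota.
Qed.

Lemma partition_mem r p (i : 'I_r) : ordered_partition r p ->
  exists2 P, P \in p & val i \in P.
Proof.
move=> /and3P[_ _ /eqP U]; apply/mem_bigfcup.
by rewrite U !inE mem_iota /=.
Qed.

Lemma card_fset_ord r (P : {fset nat}) : (forall x, x \in P -> (x < r)%N) ->
  #|` P| = (\sum_(i < r) (val i \in P))%N.
Proof.
move=> Pr; have -> : #|` P| = size [seq val i | i : 'I_r <- enum 'I_r & val i \in P].
  apply/perm_size/uniq_perm; first exact: fset_uniq.
    by rewrite (map_inj_uniq (@ord_inj r)) filter_uniq ?enum_uniq.
  move=> x; apply/idP/mapP => [xP|[i + ->]]; last by rewrite mem_filter => /andP[].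
  by exists (Ordinal (Pr x xP)) => //; rewrite mem_filter mem_enum xP.
rewrite size_map size_filter -sum1_count big_enum_cond /= big_mkcond.
by apply: eq_bigr => i _; case: (_ \in _).
Qed.

Lemma sum_mem_disjoint (p : seq {fset nat}) x : pairwise fdisjoint p ->
  (\sum_(P <- p) (x \in P) = (x \in (\bigcup_(P <- p) P)%fset))%N.
Proof.
elim: p => [|P p IH] /=; first by rewrite !big_nil.
move=> /andP[/allP Pp pp]; rewrite !big_cons IH // inE.
have [xP|//] := boolP (x \in P).
suff -> : x \in (\bigcup_(P <- p) P)%fset = false by [].
apply/negP => /mem_bigfcup[P' P'p xP'].
by have /fdisjointP/(_ x xP) := Pp P' P'p; rewrite xP'.
Qed.

Lemma card_initial_union r p j : ordered_partition r p ->
  (\sum_(P <- take j p) #|` P| = #|initial_union r p j|)%N.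
Proof.
move=> pp; have /and3P[_ dp _] := pp.
have dj : pairwise fdisjoint (take j p).
  by move: dp; rewrite -{1}(cat_take_drop j p) pairwise_cat => /and3P[].
rewrite (eq_big_seq (fun P : {fset nat} => \sum_(i < r) (val i \in P))%N) => [|P Pj]; last first.
  by apply: card_fset_ord => x; apply: partition_lt pp _; exact: mem_take Pj.
rewrite exchange_big /= -sum1_card [RHS]big_mkcond /=; apply: eq_bigr => i _.
by rewrite sum_mem_disjoint // inE; case: (_ \in _).
Qed.

Lemma faceE (R : realType) r p : ordered_partition r p ->
  face R r p = permutohedron R r `&` [set x | forall j, (0 < j < size p)%N ->
    ssum x (initial_union r p j) == std (initial_union r p j)].
Proof.
move=> pp; rewrite /face; congr (_ `&` _); apply/seteqP.
have E (x : 'rV[R]_r) j : \sum_(i < r | val i \in (\bigcup_(P <- take j p) P)%fset) x 0 i =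
    ssum x (initial_union r p j) by apply: eq_bigl => i; rewrite inE.
have T j : (\sum_(1 <= k < (\sum_(P <- take j p) #|` P|).+1) k)%N%:R =
    std (initial_union r p j) :> R by rewrite sum_tri (card_initial_union j pp).
split=> x /= H j jp; have := H j jp; rewrite E T; first by move=> ->.
by move/eqP.
Qed.

Lemma initial_union_all r p j : ordered_partition r p -> (size p <= j)%N ->
  initial_union r p j = finset.setT.
Proof.
move=> pp jp; apply/setP => i; rewrite inE finset.in_setT take_oversize //.
by have [P Pp iP] := partition_mem i pp; apply/mem_bigfcup; exists P.
Qed.

Lemma mem_block r p j (i : 'I_r) : ordered_partition r p -> (j < size p)%N ->
  (val i \in nth fset0 p j) =
  (i \in initial_union r p j.+1) && (i \notin initial_union r p j).
Proof.
move=> /and3P[_ dp _] jp; rewrite !inE (take_nth fset0) //.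
rewrite -cats1 big_cat big_seq1 inE.
have [iu|] /= := boolP (val i \in (\bigcup_(P <- take j p) P)%fset); last by rewrite andbT.
apply/negP => iP.
move: dp; rewrite -{1}(cat_take_drop j p) (drop_nth fset0) // pairwise_cat.
move=> /and3P[/allrelP D _ _]; have /mem_bigfcup[P Pj iP'] := iu.
have /fdisjointP/(_ _ iP') := D P (nth fset0 p j) Pj (mem_head _ _).
by rewrite iP.
Qed.

(** Effect on one block of all the reductions in s at once, in the original labels. *)
Definition reduced_block (s : seq nat) (P : {fset nat}) : {fset nat} :=
  [fset (x - count (fun b => b < x) s)%N | x in P & x \notin s]%fset.

Lemma reduced_blockP s P y :
  reflect (exists x, [/\ x \in P, x \notin s & y = x - count (fun b => b < x) s]%N)
    (y \in reduced_block s P).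
Proof.
rewrite /reduced_block; apply: (iffP (imfsetP _ _ _ _)) => /= [[x]|[x [xP xs ->]]].
  by rewrite !inE => /andP[xP xs] ->; exists x.
by exists x; rewrite // !inE xP.
Qed.

(** Going downwards, a reduction at b leaves the labels below b alone, so later reductions still
    refer to original labels; a label above b drops by one but stays above everything left in s. *)
Lemma foldl_reductionE s p : sorted gtn s ->
  foldl reduction p s = [seq reduced_block s P | P <- p].
Proof.
elim: s p => [|b s IH] p /=.
  move=> _; rewrite -[LHS]map_id; apply: eq_map => P.
  apply/fsetP => y; apply/idP/reduced_blockP => [yP|[x [xP _ ->]]].
    by exists y; rewrite subn0.
  by rewrite subn0.
move=> bs; rewrite IH ?(path_sorted bs) // /reduction -map_comp.
have sb x : x \in s -> (x < b)%N.
  move: bs; rewrite path_sortedE => [/andP[/allP + _]|a d e e1 e2]; first exact.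
  exact: ltn_trans e2 e1.
apply: eq_map => P /=; apply/fsetP => y.
have bs' : b \notin s by apply/negP => /sb; rewrite ltnn.
have csz x : (b <= x)%N -> count (fun d => d < x)%N s = size s.
  move=> bx; apply/eqP; rewrite -all_count; apply/allP => d /sb db.
  exact: leq_trans db bx.
apply/reduced_blockP/reduced_blockP => -[x [xP xs ->]].
  move: xP => /imfsetP[/= z]; rewrite !inE => /andP[zb zP] xE.
  exists z; rewrite in_cons negb_or zb; move: xs; rewrite {}xE /=.
  have [zltb xs|bltz xs|zeqb] := ltngtP z b; last by rewrite zeqb eqxx in zb.
    by split; rewrite ?add0n.
  split=> //; first by apply/negP => /sb; lia.
  by rewrite !csz; lia.
move: xs; rewrite in_cons negb_or => /andP[xb xs].
exists (if (x < b)%N then x else x.-1); split.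
- by apply/imfsetP; exists x; rewrite //= !inE xb.
- case: ltngtP xb => // bx _.
  by apply/negP => /sb; lia.
- rewrite /=; case: ltngtP xb => // bx _; rewrite ?csz; lia.
Qed.
End Ordered_partitions.

(** * Reduction along the cycles of sigma *)

Section Cycle_reduction.
Variables (n c : nat) (sigma : 'S_n) (kap : 'I_n -> 'I_c) (rep : 'I_c -> 'I_n).
Hypothesis kapK : forall k, kap (rep k) = k.
Hypothesis rep_min : forall k, minimal sigma (rep k).
Hypothesis kapE : forall i, minimal sigma i ->
  kap i = #|[pred j | minimal sigma j & (j < i)%N]| :> nat.

Local Notation B := (nonminimal sigma).

Lemma mem_nonminimal (i : 'I_n) : (val i \in B) = ~~ minimal sigma i.
Proof.
apply/imfsetP/idP => [[j /= + /val_inj ->]|mi]; first by rewrite inE.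
by exists i; rewrite //= inE.
Qed.

Lemma nonminimal_lt x : x \in B -> (x < n)%N.
Proof. by move=> /imfsetP[i /= _ ->]. Qed.

(** With labels starting at 0, i is the number of labels below it; discarding the nonminimal ones
    leaves the minimal ones, which [kap] counts. *)
Lemma count_nonminimal (i : 'I_n) : minimal sigma i ->
  (i - count (fun b => b < i)%N B)%N = kap i.
Proof.
move=> mi; rewrite kapE //.
have -> : count (fun b => b < i)%N B = #|[pred j : 'I_n | ~~ minimal sigma j & (j < i)%N]|.
  rewrite -size_filter.
  transitivity (size [seq val j | j : 'I_n <-
    enum [pred j : 'I_n | ~~ minimal sigma j & (j < i)%N]]).
    apply/perm_size/uniq_perm; first by rewrite filter_uniq ?fset_uniq.
      by rewrite (map_inj_uniq (@ord_inj n)) enum_uniq.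
    move=> x; rewrite mem_filter; apply/andP/mapP => [[xi xB]|[j + ->]].
      exists (Ordinal (nonminimal_lt xB)) => //.
      by rewrite mem_enum inE xi andbT -mem_nonminimal.
    by rewrite mem_enum inE => /andP[mj ji]; rewrite mem_nonminimal.
  by rewrite size_map -cardE.
have : (#|[pred j : 'I_n | minimal sigma j & (j < i)%N]| +
        #|[pred j : 'I_n | ~~ minimal sigma j & (j < i)%N]| = i)%N.
  rewrite -!sum1_card -[RHS]card_ord -[RHS]sum1_card.
  rewrite [RHS](big_ord_widen n (fun=> 1%N)) ?(ltnW (ltn_ord i)) //.
  rewrite [RHS](bigID (minimal sigma)) /=.
  by congr (_ + _)%N; apply: eq_bigl => j; rewrite inE andbC.
by move=> E; rewrite -[X in (X - _)%N]E addnK.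
Qed.

Lemma reductionsE q : reductions q B = [seq reduced_block (sort geq B) P | P <- q].
Proof.
apply: foldl_reductionE.
rewrite gtn_sorted_uniq_geq sort_uniq fset_uniq sort_sorted //; exact: leq_total.
Qed.

Lemma reduced_block_cycles (P : {fset nat}) :
  (forall x, x \in P -> x < n)%N ->
  (forall i j : 'I_n, kap i = kap j -> val i \in P -> val j \in P) ->
  forall y : nat, reflect (exists2 i : 'I_n, val i \in P & y = kap i)
    (y \in reduced_block (sort geq B) P).
Proof.
move=> Pn Psat y.
have cE x : count (fun b => b < x)%N (sort geq B) = count (fun b => b < x)%N B.
  by apply/seq.permP; rewrite perm_sort.
apply: (iffP (reduced_blockP _ _ _)) => [[x [xP + ->]]|[i iP ->]].
  pose i := Ordinal (Pn x xP); rewrite mem_sort -[x]/(val i) mem_nonminimal negbK => mi.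
  by exists i => //; rewrite cE count_nonminimal.
have ii : kap i = kap (rep (kap i)) by rewrite kapK.
exists (rep (kap i)); split; first exact: Psat ii iP.
  by rewrite mem_sort mem_nonminimal negbK.
by rewrite cE count_nonminimal ?kapK.
Qed.

Variable q : seq {fset nat}.
Hypothesis qP : ordered_partition n q.
Hypothesis q_sat : forall j, saturated kap (initial_union n q j).

Lemma block_saturated P (i j : 'I_n) : P \in q -> kap i = kap j ->
  val i \in P -> val j \in P.
Proof.
move=> Pq ij; rewrite -(nth_index fset0 Pq) !(mem_block _ qP) ?index_mem //.
move=> /andP[iA iA']; apply/andP; split; first exact: q_sat ij iA.
by apply: contra iA' => jA; exact: q_sat (esym ij) jA.
Qed.

Lemma mem_reduced (P : {fset nat}) (y : nat) : P \in q ->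
  reflect (exists2 i : 'I_n, val i \in P & y = kap i) (y \in reduced_block (sort geq B) P).
Proof.
move=> Pq; apply: reduced_block_cycles => [x|i j]; first exact: partition_lt qP Pq.
exact: block_saturated.
Qed.

(** With any element, a saturated block contains the smallest element of its cycle. *)
Lemma block_not_nonminimal P : P \in q -> ~~ (P `<=` B)%fset.
Proof.
move=> Pq; have /and3P[/allP/(_ P Pq) /fset0Pn[x xP] _ _] := qP.
pose i := Ordinal (partition_lt qP Pq xP).
apply/negP => /fsubsetP/(_ (val (rep (kap i)))).
rewrite mem_nonminimal rep_min => H; apply: notF; apply: H.
have E : kap i = kap (rep (kap i)) by rewrite kapK.
exact: block_saturated Pq E xP.
Qed.

Lemma reductions_partition : ordered_partition c (reductions q B).
Proof.
have /and3P[q0 qd /eqP qU] := qP; rewrite reductionsE; apply/and3P; split.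
- apply/allP => _ /mapP[P Pq ->]; have /fset0Pn[x xP] := allP q0 P Pq.
  apply/fset0Pn; exists (kap (Ordinal (partition_lt qP Pq xP)) : nat).
  by apply/(mem_reduced _ Pq); exists (Ordinal (partition_lt qP Pq xP)).
- rewrite pairwise_map.
  apply: (sub_in_pairwise (P := mem q) (r := fdisjoint)) qd; last exact/allP.
  move=> P P' Pq P'q /fdisjointP PP'; apply/fdisjointP => y /(mem_reduced _ Pq)[i iP ->].
  apply/negP => /(mem_reduced _ P'q)[j jP' /val_inj ij].
  by have := PP' _ (block_saturated Pq ij iP); rewrite jP'.
- apply/eqP/fsetP => y; rewrite !inE mem_iota /=; apply/mem_bigfcup/idP.
    by move=> [_ /mapP[P Pq ->] /(mem_reduced _ Pq)[i _ ->]].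
  move=> yc; have [P Pq iP] := partition_mem (rep (Ordinal yc)) qP.
  exists (reduced_block (sort geq B) P); first exact: map_f.
  by apply/(mem_reduced _ Pq); exists (rep (Ordinal yc)); rewrite ?kapK.
Qed.

(** Matches the equations of the reduced face with the sets [kap @: A] of
    [quotient_diffeomorphism]. *)
Lemma initial_union_reductions j :
  initial_union c (reductions q B) j = kap @: initial_union n q j.
Proof.
apply/setP => k; rewrite inE reductionsE -map_take; apply/mem_bigfcup/imsetP.
  move=> [_ /mapP[P Pj ->]]; have Pq := mem_take Pj.
  move=> /(mem_reduced _ Pq)[i iP /val_inj ->].
  by exists i => //; rewrite inE; apply/mem_bigfcup; exists P.
move=> [i + ->]; rewrite inE => /mem_bigfcup[P Pj iP].
exists (reduced_block (sort geq B) P); first exact: map_f.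
by apply/(mem_reduced _ (mem_take Pj)); exists i.
Qed.
End Cycle_reduction.

Lemma fixed_points_fiber (R : realType) n c m (sigma : 'S_n) (kap : 'I_n -> 'I_c) :
  #[sigma]%g = m -> (forall i j, (kap i = kap j) <-> (j \in porbit sigma i)) ->
  fixed_points m sigma (permutohedron R n) =
  permutohedron R n `&` [set x | fiber_constant kap x].
Proof.
move=> sm kap_orbit; rewrite /fixed_points; congr (_ `&` _); apply/seteqP; split=> x /= H.
  have xs j : x 0 (sigma j) = x 0 j.
    have m0 : (0 < m)%N by rewrite -sm order_gt0.
    (* Iterates run over k < m, so the generator itself is among them only for m > 1; otherwise
       sigma is the identity. *)
    have [m1|m1] := leqP m 1.
      have /eqP : #[sigma]%g == 1%N by rewrite sm eqn_leq m1.
      by move/eqP; rewrite order_eq1 => /eqP ->; rewrite perm1.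
    by have /= := H 1%N m1; move=> /matrixP/(_ 0 j); rewrite mxE.
  move=> i j /kap_orbit/porbitP[k ->]; elim: k => [|k IH]; first by rewrite perm1.
  by rewrite expgSr permM xs.
move=> k _; elim: k => //= k ->; apply/matrixP => i j; rewrite (ord1 i) mxE.
by apply/esym/H/kap_orbit; rewrite -[sigma j]/((sigma ^+ 1)%g j) mem_porbit.
Qed.

Theorem propositionB21 (R : realType) (n m p : nat) (sigma : 'S_n)
    (len : p.-tuple nat)
    (sigma_order : #[sigma]%g = m)
    (sigma_cycles : perm_eq len [seq #|C| | C : {set 'I_n} <- enum (porbits sigma)]) :
  let N := (\sum_(i < p) (tnth len i - 1))%N in
  let B := nonminimal sigma in
  exists psi : 'rV[R]_n -> 'rV[R]_(n - N),
    diffeomorphism_on (fixed_points m sigma (permutohedron R n))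
      (permutohedron R (n - N)) psi /\
    forall q : seq {fset nat}, ordered_partition n q ->
      let fixed_face :=
        face R n q `&` fixed_points m sigma (permutohedron R n) in
      fixed_face !=set0 ->
      (forall P : {fset nat}, P \in q -> ~~ (P `<=` B)%fset) /\
      psi @` fixed_face = face R (n - N) (reductions q B).
Proof.
move=> N B; have cE := card_cycles sigma_cycles; rewrite -/N in cE.
move: (n - N)%N cE => c cE.
have [kap [rep [kapK rep_min kap_orbit kapE]]] := cycle_index cE.
have FE := fixed_points_fiber R sigma_order kap_orbit.
have [psi [psi_diff psi_tight]] := @quotient_diffeomorphism R n c kap rep kapK.
exists psi; rewrite FE; split=> // q qP /=; rewrite (faceE R qP).
set F := permutohedron R n `&` _ in psi_diff psi_tight *.
move=> [x0 [[_ x0q] [x0P x0c]]].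
(* The equations of the face give x0 slack 0 at this set, the least possible value in the
   permutohedron; this is where nonemptiness is used. *)
have q_sat j : saturated kap (initial_union n q j).
  have [jq|qj] := leqP (size q) j.
    by rewrite initial_union_all // => i i' _; rewrite !finset.in_setT.
  have [->|j0] := posnP j.
    by move=> i i' _; rewrite inE take0 big_nil.
  apply: (tight_saturated x0c) => A.
  have jq : (0 < j < size q)%N by rewrite j0.
  have /eqP -> := x0q j jq.
  by rewrite subrr subr_ge0; move: x0P; rewrite permutohedronE => -[].
split=> [P|]; first exact: (block_not_nonminimal kapK rep_min qP q_sat).
have q'P := reductions_partition kapK rep_min kapE qP q_sat.
rewrite (faceE R q'P); have [[psiF _ psi_surj] _ _] := psi_diff.
have tight x j : F x -> (ssum (psi x) (initial_union c (reductions q B) j) ==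
    std (initial_union c (reductions q B) j)) =
    (ssum x (initial_union n q j) == std (initial_union n q j)).
  by move=> Fx; rewrite (initial_union_reductions kapK rep_min kapE qP q_sat) psi_tight.
have sz : size (reductions q B) = size q by rewrite reductionsE size_map.
apply/seteqP; split=> [_ [x [[Px xq] Fx] <-]|y [Py yq]].
  split; first exact: psiF.
  by move=> j; rewrite sz => jq; rewrite tight //; exact: xq.
have [x Fx xy] := psi_surj y Py; exists x => //; split=> //; split; first by case: Fx.
by move=> j jq; rewrite -tight // xy; apply: yq; rewrite sz.
Qed.
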